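(* Let $k$ be a positive integer, let $G$ be a balanced bipartite graph of order $2n > 6(k+1)$, and let $M$ be a perfect matching of $G$. Suppose that $G$ contains $k+1$ vertex-disjoint $M$-cycles, each of length at least $6$. If $\sigma_{1,1}(G) \ge n+2$, then $G$ has an $M$-$2$-factor consisting of exactly $k$ cycles, each of length at least $6$.
   Context: Graphs are finite and simple. For a bipartite graph $G$ with partite sets $X,Y$, $\sigma_{1,1}(G) = \min\{d_G(x)+d_G(y) : x \in X, y \in Y, xy \notin E(G)\}$ if $G$ is not complete bipartite, and $+\infty$ otherwise. For a matching $M$, a cycle $C$ is an $M$-cycle if $|E(C)\cap M|=|C|/2$ (it alternates between edges in $M$ and not in $M$). An $M$-$2$-factor is a spanning subgraph every component of which is an $M$-cycle. *)

(* Defs.v *)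
From mathcomp Require Import all_boot.
Set Implicit Arguments. Unset Strict Implicit. Unset Printing Implicit Defensive.

Definition simple_graph (T : finType) (e : rel T) : Prop :=
  symmetric e /\ irreflexive e.

Definition bipartition (T : finType) (e : rel T) (X : {set T}) : Prop :=
  forall x y, e x y -> (x \in X) != (y \in X).

Definition deg (T : finType) (e : rel T) (v : T) : nat := #|[set w | e v w]|.

(* sigma_{1,1}(G) >= s : every nonadjacent pair x in X, y in Y has degree sum >= s
   (vacuous when G is complete bipartite, matching sigma = +infinity). *)
Definition sigma11_ge (T : finType) (e : rel T) (X : {set T}) (s : nat) : Prop :=
  forall x y, x \in X -> y \in ~: X -> ~~ e x y -> s <= deg e x + deg e y.

Definition perfect_matching (T : finType) (e : rel T) (M : {set {set T}}) : Prop :=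
  (forall m, m \in M -> exists x y, e x y /\ m = [set x; y]) /\
  (forall v : T, #|[set m in M | v \in m]| = 1).

Definition is_cycle (T : finType) (e : rel T) (c : seq T) : bool :=
  [&& uniq c, 3 <= size c & cycle e c].

(* The edges of the cycle c are {x, next c x} for x in c (distinct, as size c >= 3).
   Number of edges of c lying in M. *)
Definition cycle_M_edges (T : finType) (M : {set {set T}}) (c : seq T) : nat :=
  count (fun x => [set x; next c x] \in M) c.

Definition M_cycle (T : finType) (e : rel T) (M : {set {set T}}) (c : seq T) : Prop :=
  is_cycle e c /\ (cycle_M_edges M c).*2 = size c.

Definition vertex_disjoint (T : finType) (cs : seq (seq T)) : bool :=
  uniq (flatten cs).

Definition M_2factor (T : finType) (e : rel T) (M : {set {set T}}) (cs : seq (seq T)) : Prop :=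
  vertex_disjoint cs /\ (forall v : T, v \in flatten cs) /\
  (forall c, c \in cs -> M_cycle e M c).

(* Main.v *)
(* Contracting the edges xx' of M turns G into a digraph on X, with an arc from x
   to y when xy' is an edge of G; M-cycles of length 2m become directed cycles of
   length m, and the condition on sigma_{1,1} becomes Woodall's condition
   d+(x) + d-(y) >= n for nonadjacent x, y.  So k+1 disjoint directed cycles of
   length at least 3 are given and k such cycles spanning all vertices are wanted,
   when n > 3(k+1).  A path can be inserted into one of several disjoint cycles as
   soon as its ends have enough arcs from and to them.

   First, a family of K cycles of maximal coverage spans, or can be turned into a
   spanning family of K-1 cycles: the uncovered vertices carry a Hamiltonian cycle,
   by exchange arguments, and this cycle together with one of
   the given cycles can be inserted into the others.

   Then let k+1 cycles span and suppose that no k cycles do.  Dissolving one cycle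
   into the others shows that the arcs between any two cycles all go the same way.
   Shortcutting a cycle frees a path which can be inserted elsewhere, so a vertex
   has at most two out- and two in-neighbours in its own cycle.  A cycle h of length
   at least 4, which exists because n > 3(k+1), must then have length 4, and
   dominate or be dominated completely by every other cycle.  Counting arcs from
   the dominated cycles to the dominating ones gives two disjoint arcs between some
   pair of cycles; cut at these arcs, the pair closes up with the two halves of h
   to two cycles instead of three. *)
Require Import Defs.
From mathcomp Require Import all_boot.
From mathcomp Require Import zify.
From Stdlib Require Import Classical.
Set Implicit Arguments. Unset Strict Implicit. Unset Printing Implicit Defensive.

(** Lists are permutations of each other when every predicate has the same count on both. Hypotheses
    and goal thus become linear equations between the counts of the pieces. *)
Ltac perm_count :=
  let P := fresh "P" in apply/permP => P;
  repeat match goal with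
  | H : is_true (perm_eq _ _) |- _ => move/permP: H => /(_ P) H
  end;
  repeat match goal with H : count _ _ = _ |- _ => revert H end;
  do 4 rewrite /= ?(count_cat, flatten_cat, cats0);
  repeat match goal with |- context [@count _ _ ?x] => move: (count _ x) => ? end;
  repeat match goal with |- context [nat_of_bool ?b] => move: (nat_of_bool b) => ? end;
  lia.

(** Induction on the bound. [Q] is an arbitrary proposition, so deciding it at [b.+1] is
    classical. *)
Lemma max_exists (Q : nat -> Prop) (b m0 : nat) :
  Q m0 -> (forall m, Q m -> m <= b) ->
  exists2 m, Q m & forall m', Q m' -> m' <= m.
Proof.
move=> Qm0 ub; move: b m0 Qm0 ub; elim=> [|b IH] m Qm leb.
  by exists m => // m' /leb; rewrite leqn0 => /eqP->.
case: (classic (Q b.+1)) => [Qb|nQb]; first by exists b.+1.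
apply: (IH m) => // m' Qm'; have := leb _ Qm'; rewrite leq_eqVlt ltnS.
by case/orP => // /eqP eqb; case: nQb; rewrite -eqb.
Qed.

(** * Paths and cycles as lists *)

Section Link.
Variables (V : eqType) (r : rel V).

(* True by default if [a] or [b] is empty, so that [sorted_catE] has no side condition. *)
Definition lk (a b : seq V) : bool :=
  if a is x :: a' then if b is y :: _ then r (last x a') y else true else true.

Lemma sorted_catE a b :
  sorted r (a ++ b) = [&& sorted r a, lk a b & sorted r b].
Proof. by case: a => [|x a] //; case: b => [|y b]; rewrite /= ?cats0 ?andbT // cat_path. Qed.

Lemma lk_catl a b c : b != [::] -> lk (a ++ b) c = lk b c.
Proof. by case: a => [|x a] //; case: b => [|y b] //= _; rewrite last_cat. Qed.

Lemma lk_catr a b c : b != [::] -> lk a (b ++ c) = lk a b.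
Proof. by case: b. Qed.

Lemma cycleE c : cycle r c = sorted r c && lk c c.
Proof. by case: c => [|x c] //=; rewrite rcons_path. Qed.

Lemma cycle_catE a b : a != [::] -> b != [::] ->
  cycle r (a ++ b) = [&& sorted r a, lk a b, sorted r b & lk b a].
Proof. by move=> a0 b0; rewrite cycleE sorted_catE lk_catl // lk_catr // !andbA. Qed.

Lemma cycle_catC a b : cycle r (a ++ b) = cycle r (b ++ a).
Proof. by rewrite -(rot_size_cat a b) rot_cycle. Qed.

(** Pigeonhole over the [size s] pairs of neighbours in [x :: s]: their first elements run through
    [belast x s], their second ones through [s]. *)
Lemma consecutive0 (P Q : pred V) x (s : seq V) :
  size s < count P (belast x s) + count Q s ->
  exists a m m' b, [/\ x :: s = (a ++ [:: m]) ++ m' :: b, P m & Q m'].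
Proof.
elim: s x => [|y s IH] x //=.
case Pxy: (P x && Q y) => lts.
  by case/andP: Pxy => Px Qy; exists [::], x, y, s.
have [|a [x' [y' [b [-> Px' Qy']]]]] := IH y.
  by case: (P x) (Q y) Pxy lts => [] [] //= _; lia.
by exists (x :: a), x', y', b; rewrite /= -?catA.
Qed.

(** The last element of [s] begins no pair and the first one ends none; these two add at most 2 to
    the bound [size s - 1] for the pairs. *)
Lemma consecutive (P Q : pred V) (s : seq V) :
  (size s).+1 < count P s + count Q s ->
  exists a m m' b, [/\ s = (a ++ [:: m]) ++ m' :: b, P m & Q m'].
Proof.
case: s => [|x s] // lts; apply: consecutive0; move: lts.
have -> : count P (x :: s) = count P (belast x s) + P (last x s).
  by rewrite lastI -cats1 count_cat /= addn0.
by case: (Q x) (P (last x s)) => [] [] /=; lia.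
Qed.

(** Cyclic form: repeating the head at the end gives [size s] pairs without any loss. The rotation
    opens the cycle between the two elements found. *)
Lemma rot_consecutive (P Q : pred V) (s : seq V) :
  size s < count P s + count Q s ->
  exists j y b, [/\ rot j s = y :: b, P (last y b) & Q y].
Proof.
case: s => [|x s] // lts.
have [|a [m [m' [b [E Pm Qm]]]]] := @consecutive0 P Q x (rcons s x).
  by rewrite belast_rcons size_rcons -cats1 !count_cat /=; move: lts => /=; lia.
have {}E : rcons (x :: s) x = (a ++ [:: m]) ++ m' :: b by rewrite rcons_cons.
case/lastP: b E => [|b z].
  rewrite cats1 => /rcons_inj[E zx]; exists 0, x, s; split; [exact: rot0 | | by rewrite zx].
  by have /= lE := congr1 (last x) E; rewrite lE last_cat.
rewrite -rcons_cons -rcons_cat => /rcons_inj[E _].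
exists (size (a ++ [:: m])), m', (b ++ a ++ [:: m]).
by rewrite E rot_size_cat !last_cat.
Qed.

(** Start the cycle at an element of [Y], go to the last element of [X], then on to the next element
    of [Y], possibly the start again. [J] is what lies strictly between these two. *)
Lemma rot_gap (X Y : pred V) (c : seq V) : has X c -> has Y c ->
  exists j J y M, [/\ rot j c = J ++ y :: M, Y y, X (last y M),
                     ~~ has X J & ~~ has Y J].
Proof.
move=> hX /hasP[y0 /rot_to[j c' Ec'] Yy0].
have hX' : has X (y0 :: c') by rewrite -Ec' has_rot.
have split_last (s : seq V) : has X s ->
    exists s1 x s2, [/\ s = rcons s1 x ++ s2, X x & ~~ has X s2].
  elim: s {hX' hX} => //= z s IH; case: (boolP (has X s)) => [/IH[s1 [x [s2 [-> Xx n2]]]] _|n].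
    by exists (z :: s1), x, s2.
  by rewrite orbF => Xz; exists [::], z, s.
have [s1 [x [s2 [E Xx n2]]]] := split_last _ hX'.
have rE u v : y0 :: c' = u ++ v -> exists j', rot j' c = v ++ u.
  move=> Euv; exists (rot_add c j (size u)).
  by rewrite -rot_rot_add Ec' Euv rot_size_cat.
case: (boolP (has Y s2)) => [hY|nY].
  have [J [y [s3 [E3 Yy nJ]]]] : exists J y s3, [/\ s2 = J ++ y :: s3, Y y & ~~ has Y J].
    elim: {E n2} s2 hY => //= z s IH; case: (boolP (Y z)) => [Yz _|nYz /= /IH[J [y [s3 [-> Yy
        nJ]]]]].
      by exists [::], z, s.
    by exists (z :: J), y, s3; rewrite /= negb_or nYz.
  have [j' Ej'] := rE _ _ E; exists j', J, y, (s3 ++ rcons s1 x).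
  rewrite Ej' E3 -catA /= last_cat last_rcons; split=> //.
  by move: n2; rewrite E3 has_cat negb_or => /andP[].
(* No element of [Y] follows [x], so the next one is the start [y0], which is [x] itself if [s1] is
   empty. *)
have [j' Ej'] := rE _ _ E.
case: s1 E Ej' => [|z s1] /= [yz _] Ej'.
  by exists j', s2, x, [::]; rewrite -{2}yz.
by exists j', s2, z, (rcons s1 x); rewrite last_rcons -{2}yz.
Qed.
End Link.

Lemma mem_split (V : eqType) (x : V) s :
  x \in s -> exists s1 s2, s = (s1 ++ [:: x]) ++ s2.
Proof. by case/splitPr=> s1 s2; exists s1, s2; rewrite -catA. Qed.

Lemma uniq_last_head (V : eqType) (v : V) a :
  uniq (v :: a) -> last v a = v -> a = [::].
Proof.
case/lastP: a => // a x /= /andP[va _]; rewrite last_rcons => xv.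
by rewrite xv mem_rcons mem_head in va.
Qed.

Lemma sub_in_count (V : eqType) (P Q : pred V) s :
  {in s, subpred P Q} -> count P s <= count Q s.
Proof.
move=> sub; rewrite (eq_in_count (a2 := predI (mem s) P)).
  by apply: sub_count => x /= /andP[xs /(sub x xs)].
by move=> x /= ->.
Qed.

(** * Hamiltonian cycles *)

Section Hamiltonian.
Variables (V : eqType) (r : rel V).
Hypothesis r_irr : irreflexive r.

Definition outd (s : seq V) u := count (r u) s.
Definition ind (s : seq V) v := count (r^~ v) s.

Lemma outd_lt s u : u \in s -> outd s u < size s.
Proof.
move=> us; rewrite -(count_predC (r u) s) -[X in X < _]addn0 ltn_add2l -has_count.
by apply/hasP; exists u; rewrite //= r_irr.
Qed.

Lemma ind_lt s v : v \in s -> ind s v < size s.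
Proof.
move=> vs; rewrite -(count_predC (r^~ v) s) -[X in X < _]addn0 ltn_add2l -has_count.
by apply/hasP; exists v; rewrite //= r_irr.
Qed.

Lemma outd_perm s s' u : perm_eq s s' -> outd s u = outd s' u.
Proof. by move/permP=> E; apply: E. Qed.

Lemma ind_perm s s' u : perm_eq s s' -> ind s u = ind s' u.
Proof. by move/permP=> E; apply: E. Qed.

Lemma outd_cat s s' u : outd (s ++ s') u = outd s u + outd s' u.
Proof. exact: count_cat. Qed.

Lemma ind_cat s s' u : ind (s ++ s') u = ind s u + ind s' u.
Proof. exact: count_cat. Qed.

Lemma outd_has s u : ~~ has (r u) s -> outd s u = 0.
Proof. by rewrite has_count -eqn0Ngt => /eqP. Qed.

Lemma ind_has s v : ~~ has (r^~ v) s -> ind s v = 0.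
Proof. by rewrite has_count -eqn0Ngt => /eqP. Qed.

Variable s : seq V.
(** Woodall's condition is asked only for the ends of Hamiltonian paths of [s], and of prefixes of
    such paths whose remainder closes up. For these ends it can be derived from the failure to
    insert the path elsewhere. *)
Hypothesis full_path : forall v p, perm_eq (v :: p) s -> sorted r (v :: p) ->
  last v p != v -> r (last v p) v \/ size s <= outd s (last v p) + ind s v.
Hypothesis prefix_path : forall v a y b, perm_eq ((v :: a) ++ y :: b) s ->
  sorted r ((v :: a) ++ y :: b) -> r (last y b) y -> last v a != v ->
  r (last v a) v \/ size s <= outd s (last v a) + ind s v.

(* No arc leads from a last vertex of the rotated cyclic tail [b] to [v :: a], since
   this would give a longer cyclic tail.  Inserting the stretch [J] of [b] between the
   attachments of the ends of [v :: a] at the two ends of the path makes the degree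
   sums of the two resulting paths contradictory. *)
Lemma max_cyclic_tail v a y b : uniq s ->
  perm_eq ((v :: a) ++ y :: b) s -> sorted r ((v :: a) ++ y :: b) ->
  r (last y b) y ->
  (forall A' B', perm_eq (A' ++ B') s -> sorted r (A' ++ B') -> B' != [::] ->
     lk r B' B' -> size B' <= size (y :: b)) -> False.
Proof.
set A := v :: a; set B := y :: b; set w := last v a => us pAB sAB cB Hmax.
have factA A' y' B' x : perm_eq (A' ++ y' :: B') s -> sorted r (A' ++ y' :: B') ->
    size (y' :: B') = size B -> x \in A' -> ~~ r (last y' B') x.
  move=> p1 s1 sz xA; apply/negP=> rx; case/splitPr: xA p1 s1 => A1 A2.
  rewrite -catA => p1 s1.
  have := Hmax _ _ p1 s1 isT; rewrite /= last_cat /= -/B => /(_ rx).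
  by rewrite size_cat -/(size (y' :: B')) sz /B /=; clear; lia.
move: (sAB); rewrite sorted_catE => /and3P[sA rwy sB].
have cycB : cycle r B by rewrite cycleE; apply/andP.
have szs : size s = size A + size B by rewrite -(perm_size pAB) size_cat.
have uAB : uniq (A ++ B) by rewrite (perm_uniq pAB).
have dAB x : x \in A -> x \notin B.
  by move=> xA; apply/negP=> xB; move: uAB; rewrite cat_uniq => /and3P[_ /hasP[]]; exists x.
have wA : w \in A by exact: mem_last.
have uB' : last y b \in B by exact: mem_last.
have dv z : z \in B -> z != v.
  by move=> zB; apply/eqP=> zv; move: (dAB v (mem_head _ _)); rewrite -zv zB.
have dw z : z \in B -> z != w.
  by move=> zB; apply/eqP=> zv; move: (dAB w wA); rewrite -zv zB.
(* The path ends in [last y b], which has no arc into [A]; its degree sum with [v] therefore forces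
   arcs from [B] to [v]. *)
have hX : has (r^~ v) B.
  have lB : last v (a ++ B) = last y b by rewrite last_cat.
  have := @full_path v (a ++ B) pAB sAB; rewrite lB (dv _ uB') => /(_ isT).
  have n1 : ~~ r (last y b) v by apply: (factA A); rewrite ?mem_head.
  rewrite (negbTE n1) => -[//|].
  rewrite -(outd_perm _ pAB) -(ind_perm _ pAB) outd_cat ind_cat szs.
  have -> : outd A (last y b) = 0.
    by apply: outd_has; apply/hasPn=> x xA; apply: (factA A).
  have := outd_lt uB'; have := ind_lt (mem_head v a : v \in A).
  by rewrite has_count -/(ind B v); move: (size A) (size B) (ind A v) (ind B v) (outd B _);
      clear; lia.
have hY : has (r w) B by apply/hasP; exists y; rewrite ?mem_head.
have [j [J [z [M0 [EB rwz rxv nJX nJY]]]]] := rot_gap hX hY.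
set M := z :: M0 in EB.
have pB : perm_eq B (J ++ M) by rewrite -EB perm_sym perm_rot.
have szB : size B = size J + size M by rewrite (perm_size pB) size_cat.
have cJM : cycle r (J ++ M) by rewrite -EB rot_cycle.
have cMJ : cycle r (M ++ J) by rewrite cycle_catC.
have sM : sorted r M by move: cMJ; rewrite cycleE sorted_catE => /andP[/and3P[]].
have sMJ : sorted r (M ++ J) by move: cMJ; rewrite cycleE => /andP[].
have sJM : sorted r (J ++ M) by move: cJM; rewrite cycleE => /andP[].
have MsubB x : x \in M -> x \in B by rewrite (perm_mem pB) mem_cat => ->; rewrite orbT.
have JsubB x : x \in J -> x \in B by rewrite (perm_mem pB) mem_cat => ->.
(* With [J] empty, the tail could be rotated to end in a vertex with an arc to [v]. *)
have nJ : J != [::].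
  apply/eqP=> J0; rewrite J0 /= in EB pB szB cJM.
  have : ~~ r (last z M0) v.
    apply: (factA A); rewrite ?mem_head // ?szB //.
      by move: pAB pB; clear; move=> pAB pB; perm_count.
    by rewrite sorted_catE; apply/and3P.
  by rewrite rxv.
have pJMA : perm_eq (J ++ M ++ A) s by move: pAB pB; clear; move=> pAB pB; perm_count.
have pAMJ : perm_eq (A ++ M ++ J) s by move: pAB pB; clear; move=> pAB pB; perm_count.
have sMA : sorted r (M ++ A) by rewrite sorted_catE; apply/and3P.
have sJMA : sorted r (J ++ M ++ A).
  by rewrite catA sorted_catE lk_catl //; apply/and3P.
have sAMJ : sorted r (A ++ M ++ J).
  by rewrite sorted_catE; apply/and3P.
(* The path [J ++ M ++ A] ends in the cyclic tail [M ++ A], which is not longer than [B]. *)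
have leAJ : size A <= size J.
  have := Hmax _ _ pJMA sJMA isT; rewrite [lk _ _ _]/= last_cat /= -/w => /(_ rwz).
  by rewrite -[(size (M0 ++ v :: a)).+1]/(size (M ++ A)) size_cat; move: szB; rewrite /B /=;
      clear; lia.
(* Otherwise [B] can be opened between two consecutive vertices of [M] so that it still continues
   [A], but ends in a vertex with an arc to [v]. *)
have leM : outd M w + ind M v <= (size M).+1.
  rewrite leqNgt; apply/negP; rewrite addnC => /consecutive[M1 [m [m' [M2 [EM rm rm']]]]].
  have pB2 : perm_eq B ((m' :: M2) ++ J ++ (M1 ++ [:: m])).
    by rewrite EM in pB; move: pB; clear; move=> pB; perm_count.
  have cB2 : cycle r ((m' :: M2) ++ J ++ (M1 ++ [:: m])).
    by move: cMJ; rewrite EM -catA cycle_catC -catA.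
  have : ~~ r (last m' (M2 ++ J ++ (M1 ++ [:: m]))) v.
    apply: (factA A); rewrite ?mem_head //.
    - by move: pAB pB2; clear; move=> pAB pB2; perm_count.
    - move: cB2; rewrite cycleE => /andP[sB2 _]; rewrite sorted_catE.
      by apply/and3P.
    - by rewrite -(perm_size pB2).
  by rewrite !last_cat /= rm.
have outJ0 : outd J w = 0 by exact: outd_has.
have inJ0 : ind J v = 0 by exact: ind_has.
have outA := outd_lt wA; have inA := ind_lt (mem_head v a : v \in A).
have pABJM : perm_eq s (A ++ J ++ M) by move: pAB pB; clear; move=> pAB pB; perm_count.
(* [A] closes up as well: otherwise the degree sum of its ends is at most
   [2 * (size A - 1) + size M + 1], which is below [size s] because [size A <= size J]. *)
have cycA : w = v \/ r w v.
  case: (eqVneq w v) => [|nwv]; first by left.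
  have [|] := prefix_path pAB sAB cB nwv; first by right.
  rewrite (outd_perm _ pABJM) (ind_perm _ pABJM) !outd_cat !ind_cat outJ0 inJ0.
  by move: szs szB leM leAJ outA inA; rewrite -/w; clear; lia.
case: J nJ EB pB szB cJM cMJ sMJ sJM JsubB nJX nJY pJMA pAMJ sJMA sAMJ leAJ outJ0 inJ0 pABJM
  => // v' J' _ EB; set J := v' :: J'; set u' := last v' J'.
move=> pB szB cJM cMJ sMJ sJM JsubB nJX nJY pJMA pAMJ sJMA sAMJ leAJ outJ0 inJ0 pABJM.
have v'J : v' \in J by exact: mem_head.
have u'J : u' \in J by exact: mem_last.
have nwv' : ~~ r w v' by exact: (hasPn nJY).
have nu'v : ~~ r u' v by exact: (hasPn nJX).
have lE1 : last v' (J' ++ M ++ A) = w by rewrite last_cat /= last_cat.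
have lE2 : last v (a ++ M ++ J) = u' by rewrite last_cat /= last_cat.
have := @full_path v' (J' ++ M ++ A) pJMA sJMA.
rewrite lE1 eq_sym dw ?JsubB // (negbTE nwv') => /(_ isT)[//|le1].
have := @full_path v (a ++ M ++ J) pAMJ sAMJ.
rewrite lE2 dv ?JsubB // (negbTE nu'v) => /(_ isT)[//|le2].
have lMJ : last z (M0 ++ J) = u' by rewrite last_cat.
have outA0 : outd A u' = 0.
  apply: outd_has; apply/hasPn=> x xA; rewrite -lMJ; apply: (factA A) => //.
  by rewrite -[z :: _]/(M ++ J) size_cat szB addnC.
(* Since [A] closes up, it can be rotated to end in [x]; an arc from [x] to [v'] would then continue
   it by [J ++ M], whose last vertex has an arc to [v]. *)
have inA0 : ind A v' = 0.
  apply: ind_has; apply/hasPn=> x xA; apply/negP=> /= rxv'.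
  case: (cycA) => [wv|rwv].
    have a0 : a = [::].
      by apply: (@uniq_last_head _ v) => //; move: uAB; rewrite cat_uniq => /andP[].
    have xw : x = w by move: xA; rewrite /A a0 inE wv => /eqP.
    by rewrite xw (negbTE nwv') in rxv'.
  have cA : cycle r A by rewrite cycleE; apply/andP.
  have [A1 [A2 EA]] := mem_split xA.
  have cA' : cycle r (A2 ++ A1 ++ [:: x]) by rewrite cycle_catC -EA.
  have /negP[] : ~~ r (last v' (J' ++ M)) v.
    apply: (factA (A2 ++ A1 ++ [:: x])).
    - by rewrite EA in pAMJ; move: pAMJ; clear; move=> pAMJ; perm_count.
    - move: cA'; rewrite cycleE => /andP[sA' _].
      rewrite sorted_catE lk_catl; last by case: (A1).
      by rewrite lk_catl //; apply/and3P.
    - by rewrite szB -size_cat.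
    - by have := mem_head v a; rewrite -/A EA !mem_cat => /orP[/orP[]|] ->; rewrite ?orbT.
  by rewrite last_cat /= rxv.
(* Otherwise [J] fits between two consecutive vertices of [M], and with [A] this closes to a
   Hamiltonian cycle. *)
have leM2 : outd M u' + ind M v' <= (size M).+1.
  rewrite leqNgt; apply/negP; rewrite addnC => /consecutive[M1 [m [m' [M2 [EM rm rm']]]]].
  have M10 : M1 ++ [:: m] != [::] by case: (M1).
  set C := (M1 ++ [:: m]) ++ J ++ (m' :: M2) ++ A.
  have pC : perm_eq C s.
    by rewrite /C; rewrite EM in pAMJ; move: pAMJ; clear; move=> pAMJ; perm_count.
  have sC : sorted r C.
    have := sMA; rewrite EM -catA sorted_catE => /and3P[sM1 _ sM2].
    rewrite sorted_catE; apply/and3P; split=> //; first by rewrite lk_catl.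
    rewrite sorted_catE; apply/and3P; split=> //.
    by move: (sJM); rewrite sorted_catE => /andP[].
  have lC : lk r C C.
    have lkAM : lk r A M by [].
    by rewrite {1}/C !lk_catl // /C lk_catr //; move: lkAM; rewrite EM lk_catr.
  have nC : C != [::] by rewrite /C; case: (M1).
  have := Hmax [::] C pC sC nC lC.
  by rewrite (perm_size pC) szs -/B /A /=; clear; lia.
have outJ := outd_lt u'J; have inJ := ind_lt v'J.
(* The two degree sums add up to at most [2 * (size A - 1) + 2 * (size J - 1) + 2 * (size M + 1)],
   which is less than [2 * size s]. *)
move: le1 le2.
rewrite !(outd_perm _ pABJM) !(ind_perm _ pABJM) !outd_cat !ind_cat outJ0 inJ0 outA0 inA0.
by move: szs szB leM leM2 outJ inJ outA inA; rewrite -/w; clear; lia.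
Qed.

(* A Hamiltonian path whose end sees a vertex [y] of the path ends in a cycle through
   [y]; take this cyclic tail as long as possible. *)
Lemma hamiltonian v p : uniq s -> perm_eq (v :: p) s -> sorted r (v :: p) ->
  exists2 c, perm_eq c s & (size c == 1) || cycle r c.
Proof.
move=> us pp sp; case: (eqVneq (last v p) v) => [lv|nlv].
  by exists (v :: p) => //; rewrite (uniq_last_head _ lv) // (perm_uniq pp).
apply: NNPP => nH.
have nc : ~~ r (last v p) v.
  by apply/negP=> rv; apply: nH; exists (v :: p) => //; rewrite orbC cycleE sp /= rv.
have [//|le0] := full_path pp sp nlv; first by rewrite (negbTE nc).
pose Q m := exists A B, [/\ perm_eq (A ++ B) s, sorted r (A ++ B), B != [::],
                          lk r B B & size B = m].
have [m [A [B [pAB sAB nB lB szB]]] Hmax] : exists2 m, Q m & forall m', Q m' -> m' <= m.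
  (* As [v] has in-degree below [size s], the last vertex has an arc back into the path, where a
     cyclic tail begins. *)
  have hu : has (r (last v p)) (v :: p).
    rewrite has_count -/(outd _ _) (outd_perm _ pp).
    have vs : v \in s by rewrite -(perm_mem pp) mem_head.
    by have := ind_lt vs; move: le0; clear; lia.
  case/hasP: hu => z zp rz.
  have [A [B EA]] : exists A B, v :: p = A ++ z :: B.
    by case/splitPr: zp => A B; exists A, B.
  have lE : last v p = last z B by rewrite -[LHS]/(last v (v :: p)) EA last_cat.
  apply: (@max_exists Q (size s) (size (z :: B))).
    by exists A, (z :: B); rewrite -EA /= -lE.
  by move=> m [A' [B' [pAB _ _ _ <-]]]; rewrite -(perm_size pAB) size_cat leq_addl.
case: B nB pAB sAB lB szB => // y b _ pAB sAB lB szB.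
case: A pAB sAB => [|v' a] pAB sAB.
  by apply: nH; exists (y :: b) => //; rewrite orbC cycleE; apply/orP; left; apply/andP.
apply: (max_cyclic_tail us pAB sAB lB) => A' B' pA' sA' nB' lB'.
by rewrite szB; apply: Hmax; exists A', B'.
Qed.
End Hamiltonian.

(** * Cycle factors of digraphs *)

Section Digraph.
Variables (V : eqType) (U : seq V) (r : rel V).
Hypothesis U_uniq : uniq U.
Hypothesis r_irr : irreflexive r.
Hypothesis woodall : forall x y, x != y -> ~~ r x y ->
  size U <= outd r U x + ind r U y.

Local Notation outd := (outd r).
Local Notation ind := (ind r).

Definition long_cycle (c : seq V) := (2 < size c) && cycle r c.

Definition cycle_factor k := exists fs,
  [/\ size fs = k, all long_cycle fs & perm_eq (flatten fs) U].

(** * Inserting and exchanging paths *)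

Lemma woodallE s x y : perm_eq s U -> x != y -> ~~ r x y ->
  size s <= outd s x + ind s y.
Proof.
move=> ps nxy nr; rewrite (outd_perm _ _ ps) (ind_perm _ _ ps) (perm_size ps).
exact: woodall.
Qed.

(** A sum exceeding the total size exceeds the size of some cycle of [fs]. On that cycle, two
    consecutive vertices can take the path between them. *)
Lemma insert_path fs v p : all long_cycle fs -> sorted r (v :: p) ->
  size (flatten fs) < ind (flatten fs) v + outd (flatten fs) (last v p) ->
  exists c fs', [/\ (size fs').+1 = size fs, long_cycle c, all long_cycle fs',
    {subset v :: p <= c} & perm_eq (c ++ flatten fs') (flatten fs ++ v :: p)].
Proof.
elim: fs => [|c fs IH] //= /andP[lc lfs] sp.
case: (leqP (ind c v + outd c (last v p)) (size c)) => [le|gt _].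
  rewrite size_cat ind_cat outd_cat => lt.
  have [||| c' [fs' [sz lc' lfs' sub pe]]] := IH => //; first by move: lt le; clear; lia.
  exists c', (c :: fs'); split=> //=; rewrite ?sz ?lc //.
  by move: pe; clear; move=> pe; perm_count.
have [j [y [b [E rv ry]]]] := rot_consecutive gt.
have cyb : cycle r (y :: b) by rewrite -E rot_cycle; case/andP: lc.
have pc : perm_eq c (y :: b) by rewrite -E perm_sym perm_rot.
exists ((y :: b) ++ v :: p), fs; split=> //.
- apply/andP; split.
    by rewrite size_cat -(perm_size pc); case/andP: lc => + _; clear; lia.
  rewrite cycle_catE //; apply/and4P; split=> //.
  by move: cyb; rewrite cycleE => /andP[].
- by move=> z zp; rewrite mem_cat zp orbT.
- by move: pc; clear; move=> pc; perm_count.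
Qed.

(** A closed path of any length: a remainder may be a single vertex, which has no loop, or a cycle
    of length 2. *)
Definition traceable_cycle (s : seq V) := (size s == 1) || cycle r s.

Lemma traceable_cycle_sorted s : traceable_cycle s -> sorted r s.
Proof. by case/orP; [case: s => [|x []] | rewrite cycleE => /andP[]]. Qed.

Lemma traceable_cycle_rot j s : traceable_cycle (rot j s) = traceable_cycle s.
Proof. by rewrite /traceable_cycle size_rot rot_cycle. Qed.

(* The stretch [J] between the attachments of [rho] on [c] is not adjacent to
   [rho], so its ends have a large degree sum outside [rho]; if no Hamiltonian
   path of [rho] can be inserted, [J] can be inserted elsewhere once a segment
   of [rho] has taken its place. *)
Lemma exchange k c E rho :
  (size E).+1 = k -> long_cycle c -> all long_cycle E ->
  perm_eq (c ++ flatten E ++ rho) U -> rho != [::] -> traceable_cycle rho ->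
  ~ cycle_factor k ->
  has (fun x => has (r x) rho) c -> has (fun y => has (r^~ y) rho) c ->
  (exists x, [/\ x \in c,
     forall z, z \in c -> has (r z) rho || has (r^~ z) rho -> z = x &
     forall q q', q \in rho -> q' \in rho -> r x q -> r q' x -> q = q']) \/
  (exists j pi sigma c' E', [/\ rot j rho = pi ++ sigma, pi != [::],
     (size E').+1 = k, long_cycle c' & all long_cycle E'] /\
     [/\ perm_eq (c' ++ flatten E' ++ sigma) U, {subset pi <= c'} &
     forall z, z \in c -> has (r z) rho || has (r^~ z) rho -> z \in c']).
Proof.
move=> szE lc lE span nrho hrho nk hX hY.
have [j0 [J [y [M0 [Ec Yy Xx nJX nJY]]]]] := rot_gap hX hY.
set M := y :: M0 in Ec; set x := last y M0 in Xx.
have pc : perm_eq c (J ++ M) by rewrite -Ec perm_sym perm_rot.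
have cJM : cycle r (J ++ M) by rewrite -Ec rot_cycle; case/andP: lc.
have cMJ : cycle r (M ++ J) by rewrite cycle_catC.
have adjM z : z \in c -> has (r z) rho || has (r^~ z) rho -> z \in M.
  rewrite (perm_mem pc) mem_cat => /orP[zJ|//].
  by rewrite (negbTE (hasPn nJX z zJ)) (negbTE (hasPn nJY z zJ)).
(* The segment from [q] to [q'] will close up with [M]. If [M] is a single vertex, the segment needs
   two vertices to give a cycle of length at least 3. *)
case: (classic (exists q q', [/\ q \in rho, q' \in rho, r x q, r q' y & M0 = [::] -> q !=
    q'])); last first.
  move=> nq; left; exists x.
  have M00 : M0 = [::].
    apply: NNPP => M00; apply: nq; case/hasP: Xx => q qr xq; case/hasP: Yy => q' q'r qy.
    by exists q, q'; split.
  split.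
  - by rewrite (perm_mem pc) mem_cat mem_last orbT.
  - by move=> z zc za; have := adjM z zc za; rewrite /M /x M00 inE => /eqP.
  - move=> q q' qr q'r xq qx; apply/eqP/negP => /negP nqq; apply: nq.
    by exists q, q'; split=> //; move: qx; rewrite /x M00.
case=> q [q' [qr q'r xq qy nqq]]; right.
have [j rho1 Erho] := rot_to qr.
have srho1 : sorted r (q :: rho1).
  by apply: traceable_cycle_sorted; rewrite -Erho traceable_cycle_rot.
have [pi0 [sigma Epi]] : exists s1 s2, q :: rho1 = (s1 ++ [:: q']) ++ s2.
  by apply: mem_split; rewrite -Erho mem_rot.
set pi := pi0 ++ [:: q'] in Epi.
have npi : pi != [::] by rewrite /pi; case: (pi0).
have lkMpi : lk r M pi by rewrite -(lk_catr _ _ sigma npi) -Epi.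
have lkpiM : lk r pi M by rewrite /pi lk_catl.
have spi : sorted r pi by move: srho1; rewrite Epi sorted_catE => /andP[].
have sM : sorted r M by move: cMJ; rewrite cycleE sorted_catE => /andP[/andP[]].
have szc0 : 2 < size (M ++ pi).
  rewrite size_cat /pi size_cat /=; case: (M0) nqq => [/(_ erefl) nqq|? ? _] /=; last by clear; lia.
  move: Epi; rewrite /pi; case: (pi0) => [[qq' _]|]; last by move=> *; rewrite /=; clear; lia.
  by rewrite qq' eqxx in nqq.
have lc0 : long_cycle (M ++ pi).
  by apply/andP; split=> //; rewrite cycle_catE //; apply/and4P.
have prho : perm_eq rho (pi ++ sigma) by rewrite -Epi -Erho perm_sym perm_rot.
exists j, pi, sigma.
case: J nJX nJY Ec pc cJM cMJ => [|v J'] nJX nJY Ec pc cJM cMJ.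
  exists (M ++ pi), E; split; split=> //; first by rewrite Erho.
  - by apply: perm_trans span; move: pc prho; clear; move=> pc prho; perm_count.
  - by move=> z zp; rewrite mem_cat zp orbT.
  - by move=> z zc za; rewrite mem_cat adjM.
set J := v :: J' in nJX nJY Ec pc cJM cMJ; set u := last v J'.
have uJ : u \in J by exact: mem_last.
have vJ : v \in J by exact: mem_head.
have sJ : sorted r J by move: cJM; rewrite cycleE sorted_catE => /andP[/andP[]].
case: rho span nrho hrho hX hY Yy Xx nJX nJY adjM qr q'r Erho prho => // q0 rho' span _.
set rho := q0 :: rho'; set p0 := last q0 rho' => hrho hX hY Yy Xx nJX nJY adjM qr q'r Erho prho.
have srho := traceable_cycle_sorted hrho.
have q0r : q0 \in rho by exact: mem_head.
have p0r : p0 \in rho by exact: mem_last.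
have bE : ind (flatten E) q0 + outd (flatten E) p0 <= size (flatten E).
  rewrite leqNgt; apply/negP=> /(insert_path lE srho)[c1 [E1 [sz1 lc1 lE1 _ p1]]].
  apply: nk; exists (c :: c1 :: E1); rewrite /= sz1; split=> //; first by apply/and3P.
  by apply: perm_trans span; move: p1; clear; move=> p1; perm_count.
have bM : ind M q0 + outd M p0 <= (size M).+1.
  rewrite leqNgt; apply/negP=> /consecutive[M1 [m [m' [M2 [EM rm rm']]]]].
  have cin : cycle r ((m' :: M2) ++ J ++ (M1 ++ [:: m])).
    by move: cMJ; rewrite EM -catA cycle_catC -catA.
  have lcin : long_cycle (((m' :: M2) ++ J ++ (M1 ++ [:: m])) ++ rho).
    apply/andP; split.
      by case/andP: lc => + _; rewrite (perm_size pc) EM !size_cat /=; clear; lia.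
    rewrite cycle_catE //; apply/and4P; split=> //.
      by move: cin; rewrite cycleE => /andP[].
    by rewrite !catA lk_catl //; rewrite /= rm.
  apply: nk; exists ((((m' :: M2) ++ J ++ (M1 ++ [:: m])) ++ rho) :: E).
  split=> //=; first by apply/andP.
  apply: perm_trans span; rewrite EM in pc.
  by move: pc; clear; move=> pc; perm_count.
have spanJ : perm_eq (J ++ M ++ flatten E ++ rho) U.
  by apply: perm_trans span; move: pc; clear; move=> pc; perm_count.
have uall : uniq (J ++ M ++ flatten E ++ rho) by rewrite (perm_uniq spanJ) U_uniq.
have dJr z p : z \in J -> p \in rho -> z != p.
  move=> zJ pr; apply/eqP=> zp; move: uall; rewrite cat_uniq => /and3P[_ /hasP[]].
  by exists p; rewrite ?mem_cat ?pr ?orbT //= -zp.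
have nuq : ~~ r u q0.
  by apply/negP=> h; have /hasP[] := hasPn nJX _ uJ; exists q0.
have npv : ~~ r p0 v.
  by apply/negP=> h; have /hasP[] := hasPn nJY _ vJ; exists p0.
have le1 := woodallE spanJ (dJr _ _ uJ q0r) nuq.
have le2 := woodallE spanJ (_ : p0 != v) npv.
rewrite eq_sym dJr // in le2; move/(_ isT): le2 => le2.
have z1 : outd rho u = 0.
  by apply: outd_has; apply: (hasPn nJX).
have z2 : ind rho v = 0.
  by apply: ind_has; apply: (hasPn nJY).
have z3 : ind J q0 = 0.
  apply: ind_has; apply/hasPn=> z zJ; apply/negP=> /= h.
  by have /hasP[] := hasPn nJX _ zJ; exists q0.
have z4 : outd J p0 = 0.
  apply: outd_has; apply/hasPn=> z zJ; apply/negP=> /= h.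
  by have /hasP[] := hasPn nJY _ zJ; exists p0.
have b1 := outd_lt r_irr uJ; have b2 := ind_lt r_irr vJ.
have b3 := outd_lt r_irr p0r; have b4 := ind_lt r_irr q0r.
rewrite !outd_cat !ind_cat !size_cat z1 z2 z3 z4 in le1 le2.
(* [J], displaced by the segment, goes into [E] if it can; otherwise the two degree sums force a
   place for it between consecutive vertices of [M]. *)
case: (leqP (ind (flatten E) v + outd (flatten E) u) (size (flatten E))) => [leE|]; last first.
  case/(insert_path lE sJ) => c1 [E1 [sz1 lc1 lE1 _ p1]].
  exists (M ++ pi), (c1 :: E1); split; split=> //; rewrite ?Erho //.
  - by rewrite /= sz1.
  - by rewrite /= lc1.
  - by apply: perm_trans span; move: pc prho p1; clear; move=> pc prho p1; perm_count.
  - by move=> z zp; rewrite mem_cat zp orbT.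
  - by move=> z zc za; rewrite mem_cat adjM.
have : (size M).+1 < ind M v + outd M u.
  by move: le1 le2 bE bM b1 b2 b3 b4 leE; clear; lia.
case/consecutive=> M1 [m [m' [M2 [EM rm rm']]]].
exists (((M1 ++ [:: m]) ++ J ++ (m' :: M2)) ++ pi), E; split; split=> //; rewrite ?Erho //.
- have M10 : M1 ++ [:: m] != [::] by case: (M1).
  apply/andP; split; first by move: szc0; rewrite EM !size_cat; clear; lia.
  rewrite cycle_catE //; last by case: (M1).
  move: sM lkMpi lkpiM; rewrite EM sorted_catE lk_catl // lk_catr // => /and3P[sM1 _ sM2] lk1 lk2.
  apply/and4P; split=> //; last by rewrite lk_catr.
    rewrite sorted_catE; apply/and3P; split=> //; first by rewrite lk_catl //= rm.
    by rewrite sorted_catE; apply/and3P.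
  by move: lk1; rewrite !lk_catl.
- apply: perm_trans span; rewrite EM in pc.
  by move: pc prho; clear; move=> pc prho; perm_count.
- by move=> z zp; rewrite mem_cat zp orbT.
- move=> z zc za; have := adjM _ zc za; rewrite EM !mem_cat.
  by case/orP=> ->; rewrite ?orbT.
Qed.

Lemma no_path_insertion k fs t v p : size fs = k -> all long_cycle fs ->
  perm_eq (flatten fs ++ t) U -> perm_eq (v :: p) t -> sorted r (v :: p) ->
  ~ cycle_factor k ->
  ind (flatten fs) v + outd (flatten fs) (last v p) <= size (flatten fs).
Proof.
move=> szfs lfs span pt sp nk; rewrite leqNgt; apply/negP.
case/(insert_path lfs sp) => c [fs' [sz lc lfs' _ pe]]; apply: nk.
exists (c :: fs'); rewrite /= sz szfs lc; split=> //; apply: perm_trans span.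
by move: pe pt; clear; move=> pe pt; perm_count.
Qed.

Lemma span_neq s s' x y : perm_eq (s ++ s') U -> x \in s -> y \in s' -> x != y.
Proof.
move=> ps xs ys; apply/eqP=> xy; have := U_uniq; rewrite -(perm_uniq ps) cat_uniq.
by case/and3P=> _ /hasP[]; exists y => //=; rewrite -xy.
Qed.

(** Subtracting the arcs to and from [fs] from Woodall's condition leaves the condition inside [t],
    as [hamiltonian] asks for it. *)
Lemma path_degrees fs t v p : perm_eq (flatten fs ++ t) U ->
  v \in t -> last v p \in t ->
  ind (flatten fs) v + outd (flatten fs) (last v p) <= size (flatten fs) ->
  last v p != v -> r (last v p) v \/ size t <= outd t (last v p) + ind t v.
Proof.
move=> span vt lt le nlv; case: (boolP (r _ _)) => [|nr]; [by left | right].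
have := woodallE span nlv nr; rewrite outd_cat ind_cat size_cat.
by move: le; clear; lia.
Qed.

(** The last two conditions prevent a remainder of one or two vertices from touching [c] through one
    vertex on each side. A larger closed remainder is itself a long cycle. *)
Definition attached (c rho : seq V) := exists x x' q q',
  [/\ x \in c, x' \in c, q \in rho & q' \in rho] /\
  [/\ r x q, r q' x', size rho = 1 -> x != x' & size rho = 2 -> q != q'].

(* Segments of [rho] are moved into cycles one at a time; what is left of [rho] is
   again traceable and attached to the cycle that took the last segment. *)
Lemma dissolve k m c E rho : size rho <= m ->
  (size E).+1 = k -> long_cycle c -> all long_cycle E ->
  perm_eq (c ++ flatten E ++ rho) U -> rho != [::] -> traceable_cycle rho ->
  attached c rho -> cycle_factor k.
Proof.
elim: m c E rho => [|m IH] c E rho; first by rewrite leqn0 => /nilP->.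
move=> szm szE lc lE span nrho hrho [x [x' [q [q' [[xc x'c qr q'r] [rxq rqx n1 n2]]]]]].
apply: NNPP => nk.
have uall : uniq (c ++ flatten E ++ rho) by rewrite (perm_uniq span).
have span' : perm_eq (flatten (c :: E) ++ rho) U by rewrite /= -catA.
have hX : has (fun x => has (r x) rho) c by apply/hasP; exists x => //; apply/hasP; exists q.
have hY : has (fun y => has (r^~ y) rho) c.
  by apply/hasP; exists x' => //; apply/hasP; exists q'.
have dcr z p : z \in c -> p \in rho -> z != p.
  move=> zc pr; apply: (@span_neq (c ++ flatten E) rho); rewrite -?catA //.
  by rewrite mem_cat zc.
case: (exchange szE lc lE span nrho hrho nk hX hY).
  case=> x0 [x0c only uq].
  have xx0 : x = x0 by apply: only => //; apply/orP; left; apply/hasP; exists q.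
  have x'x0 : x' = x0 by apply: only => //; apply/orP; right; apply/hasP; exists q'.
  have qq' : q = q' by apply: uq; rewrite // -?xx0 // xx0 -x'x0.
  have sz3 : 2 < size rho.
    case: (rho) nrho n1 n2 => [|a [|b [|]]] //= _.
      by rewrite xx0 x'x0 eqxx => /(_ erefl).
    by rewrite qq' eqxx => _ /(_ erefl).
  have [j c1 Ec] := rot_to x0c.
  have pc0 : perm_eq c (x0 :: c1) by rewrite -Ec perm_sym perm_rot.
  have cyc0 : cycle r (x0 :: c1) by rewrite -Ec rot_cycle; case/andP: lc.
  have uc0 : uniq (x0 :: c1).
    by rewrite -(perm_uniq pc0); move: uall; rewrite cat_uniq => /andP[].
  have szc1 : 2 < size (x0 :: c1) by rewrite -(perm_size pc0); case/andP: lc.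
  case: c1 {Ec} pc0 cyc0 uc0 szc1 => [|z [|z' c2]] // pc0 cyc0 uc0 _.
  (* Here [rho] is a long cycle that touches [c] only at [x0]. Opened between [z] and [z'], both not
     adjacent to [rho] in the relevant direction, all of [c] is inserted into [E], and [rho]
     replaces it in the count. *)
  have cycL : cycle r ((z' :: c2) ++ [:: x0; z]) by rewrite cycle_catC.
  have sL : sorted r (z' :: c2 ++ [:: x0; z]) by move: cycL; rewrite cycleE => /andP[].
  have lastL : last z' (c2 ++ [:: x0; z]) = z by rewrite last_cat.
  have zc : z \in c by rewrite (perm_mem pc0) !inE eqxx orbT.
  have z'c : z' \in c by rewrite (perm_mem pc0) !inE eqxx !orbT.
  have free y : y \in c -> y != x0 -> ~~ (has (r y) rho || has (r^~ y) rho).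
    by move=> yc yx; apply/negP=> /(only y yc)/eqP; rewrite (negbTE yx).
  have zx0 : z != x0 by move: uc0; rewrite /= !inE eq_sym; case: eqP.
  have z'x0 : z' != x0.
    by move: uc0; rewrite /= !inE (eq_sym z'); case: (x0 == z') => //=; rewrite orbT.
  have := free z zc zx0; rewrite negb_or => /andP[fz _].
  have := free z' z'c z'x0; rewrite negb_or => /andP[_ fz'].
  case: rho span span' nrho hrho sz3 {hX hY q q' qr q'r rxq rqx n1 n2 szm uq qq'} uall dcr
      only free fz fz'
    => // q0 rho' span span' _ hrho sz3 uall dcr only free fz fz'.
  set rho := q0 :: rho' in span span' hrho sz3 uall dcr only free fz fz'.
  have q0r : q0 \in rho by exact: mem_head.
  have p0r : last q0 rho' \in rho by exact: mem_last.
  have bE : ind (flatten E) q0 + outd (flatten E) (last q0 rho') <= size (flatten E).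
    rewrite leqNgt; apply/negP => /(insert_path lE (traceable_cycle_sorted hrho)).
    case=> c1 [E1 [sz1 lc1 lE1 _ p1]].
    apply: nk; exists (c :: c1 :: E1); rewrite /= sz1; split=> //; first by apply/and3P.
    by apply: perm_trans span; move: p1; clear; move=> p1; perm_count.
  have atmost1 (P : pred V) : (forall y, y \in c -> P y -> y = x0) -> count P c <= 1.
    move=> Px0; apply: (@leq_trans (count (pred1 x0) c)); last first.
      by rewrite count_uniq_mem ?leq_b1 // (perm_uniq pc0).
    by apply: sub_in_count => y yc /(Px0 y yc) ->; rewrite /= eqxx.
  have bq : ind c q0 <= 1.
    by apply: atmost1 => y yc ry; apply: only => //; apply/orP; left; apply/hasP; exists q0.
  have bp : outd c (last q0 rho') <= 1.
    by apply: atmost1 => y yc ry; apply: only => //; apply/orP; right; apply/hasP;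
        exists (last q0 rho').
  have nzq : ~~ r z q0 by exact: (hasPn fz).
  have npz : ~~ r (last q0 rho') z' by exact: (hasPn fz').
  have le1 := woodallE span (dcr _ _ zc q0r) nzq.
  have le2 := woodallE span (_ : last q0 rho' != z') npz.
  rewrite eq_sym dcr // in le2; move/(_ isT): le2 => le2.
  have o0 : outd rho z = 0 by exact: outd_has.
  have i0 : ind rho z' = 0 by exact: ind_has.
  have b1 := outd_lt r_irr zc; have b2 := ind_lt r_irr z'c.
  have b3 := outd_lt r_irr p0r; have b4 := ind_lt r_irr q0r.
  rewrite !outd_cat !ind_cat !size_cat o0 i0 in le1 le2.
  have lt : size (flatten E) < ind (flatten E) z' + outd (flatten E) (last z' (c2 ++ [:: x0; z])).
    by rewrite lastL; move: le1 le2 bE bq bp b1 b2 b3 b4; clear; lia.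
  case: (insert_path lE sL lt) => c1 [E1 [sz1 lc1 lE1 _ p1]].
  apply: nk; exists (rho :: c1 :: E1); rewrite /= sz1; split=> //.
    apply/and3P; split=> //; rewrite /long_cycle sz3.
    by case/orP: hrho => //; rewrite eqn_leq => /andP[+ _]; rewrite leqNgt (ltnW sz3).
  apply: perm_trans span; move: p1 pc0; clear; move=> p1 pc0; perm_count.
case=> j [pi [sigma [c' [E' [[Erot npi szE' lc' lE'] [span1 pic' adjc']]]]]].
case: sigma Erot span1 => [|v sigma] Erot span1.
  apply: nk; exists (c' :: E'); rewrite /= szE' lc'; split=> //.
  by move: span1; rewrite cats0.
set s := v :: sigma in Erot span1.
case: pi npi Erot pic' => // b pi _ Erot pic'.
have szrho : size rho = (size pi).+1 + size s by rewrite -(size_rot j) Erot size_cat.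
have cycps : cycle r ((b :: pi) ++ s).
  rewrite -Erot rot_cycle; case/orP: hrho => // /eqP; rewrite szrho /s /=; clear; lia.
have prs : perm_eq rho ((b :: pi) ++ s) by rewrite -Erot perm_sym perm_rot.
have [ss rav rub] : [/\ sorted r s, r (last b pi) v & r (last v sigma) b].
  by move: cycps; rewrite cycle_catE // => /and4P[].
have bc' : b \in c' by apply: pic'; exact: mem_head.
have ac' : last b pi \in c' by apply: pic'; exact: mem_last.
have ups : uniq ((b :: pi) ++ s).
  by rewrite -(perm_uniq prs); move: uall; rewrite !cat_uniq => /and3P[_ _ /and3P[]].
have us : uniq s by move: ups; rewrite cat_uniq => /and3P[].
have szs : size s <= m by move: szm; rewrite szrho; clear; lia.
have span2 : perm_eq (flatten (c' :: E') ++ s) U by rewrite /= -catA.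
have lE2 : all long_cycle (c' :: E') by apply/andP.
have h1 v1 p : perm_eq (v1 :: p) s -> sorted r (v1 :: p) -> last v1 p != v1 ->
    r (last v1 p) v1 \/ size s <= outd s (last v1 p) + ind s v1.
  move=> ps sp; apply: (path_degrees span2).
  - by rewrite -(perm_mem ps) mem_head.
  - by rewrite -(perm_mem ps) mem_last.
  exact: (@no_path_insertion k (c' :: E') s v1 p szE' lE2 span2 ps sp nk).
have h2 v1 a y d : perm_eq ((v1 :: a) ++ y :: d) s -> sorted r ((v1 :: a) ++ y :: d) ->
    r (last y d) y -> last v1 a != v1 ->
    r (last v1 a) v1 \/ size s <= outd s (last v1 a) + ind s v1.
  move=> ps sp rly nlv.
  have : sorted r (v1 :: a) by move: sp; rewrite sorted_catE => /andP[].
  have rwy : r (last v1 a) y by move: sp; rewrite sorted_catE => /and3P[].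
  have syd : sorted r (y :: d) by move: sp; rewrite sorted_catE => /and3P[].
  move=> sa; apply: (path_degrees span2) => //.
  - by rewrite -(perm_mem ps) mem_head.
  - by rewrite -(perm_mem ps) mem_cat mem_last.
  (* If the prefix could be inserted, the closed rest [y :: d] would be attached to the cycle that
     took it, and the induction hypothesis would apply. *)
  rewrite leqNgt; apply/negP=> /(insert_path lE2 sa)[c3 [E3 [sz3 lc3 lE3 sub3 p3]]].
  apply: nk; apply: (IH c3 E3 (y :: d)) => //.
  - by apply: leq_trans szs; rewrite -(perm_size ps) size_cat leq_addl.
  - by rewrite sz3.
  - by apply: perm_trans span1; move: p3 ps; clear; move=> p3 ps; perm_count.
  - by rewrite /traceable_cycle orbC cycleE; apply/orP; left; apply/andP.
  have uyd : uniq (y :: d).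
    by move: us; rewrite -(perm_uniq ps) cat_uniq => /and3P[].
  have d0 : d != [::] by apply/negP=> /eqP d0; move: rly; rewrite d0 /= r_irr.
  have ly : last y d != y.
    by apply/negP=> /eqP /(uniq_last_head uyd) d00; rewrite d00 in d0.
  (* An arc from the tail back to the prefix is needed for the attachment. Without a suitable one,
     [last y d] has no arc to the prefix and only [y] can have one to [v1], so their degree sum is
     too small. *)
  have [z [x1 [zd x1a rz nz]]] : exists z x1, [/\ z \in y :: d, x1 \in v1 :: a, r z x1 &
      size (y :: d) = 2 -> z != y].
    apply: NNPP => nz.
    have lE1 : last v1 (a ++ y :: d) = last y d by rewrite last_cat.
    have nlv1 : last y d != v1.
      apply/eqP=> lv1; have : uniq ((v1 :: a) ++ y :: d) by rewrite (perm_uniq ps).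
      by rewrite cat_uniq => /and3P[_ /hasP[]]; exists (last y d);
          rewrite ?mem_last //= lv1 mem_head.
    have nr : ~~ r (last y d) v1.
      apply/negP=> rl; apply: nz; exists (last y d), v1; rewrite mem_head mem_last; split=> //.
    have := h1 v1 (a ++ y :: d) ps sp; rewrite lE1 nlv1 (negbTE nr) => /(_ isT)[//|].
    rewrite -(outd_perm _ _ ps) -(ind_perm _ _ ps) !outd_cat !ind_cat -(perm_size ps) size_cat.
    have -> : outd (v1 :: a) (last y d) = 0.
      apply: outd_has; apply/hasPn=> w wa; apply/negP=> rw; apply: nz.
      by exists (last y d), w; rewrite mem_last.
    have idd : ind d v1 = 0.
      apply: ind_has; apply/hasPn=> w wd; apply/negP=> rw; apply: nz.
      exists w, v1; rewrite mem_head inE wd orbT; split=> // _.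
      by apply/negP=> /eqP wy; move: uyd; rewrite /= -wy wd.
    have i1 : ind (y :: d) v1 <= 1 by rewrite -[y :: d]/([:: y] ++ d) ind_cat idd addn0;
        case: (r y v1) => //=; rewrite /ind /=; case: (r _ _).
    have := outd_lt r_irr (mem_last y d); have := ind_lt r_irr (mem_head v1 a).
    by move: i1; clear; lia.
  exists (last v1 a), x1, y, z; split; split=> //.
  - by apply: sub3; exact: mem_last.
  - exact: sub3.
  - exact: mem_head.
  - by case: (d) d0.
  - by rewrite eq_sym.
have [rho2 p2 tr2] := hamiltonian r_irr h1 h2 us (perm_refl s) ss.
have sz2 := perm_size p2.
apply: nk; apply: (IH c' E' rho2) => //.
- by rewrite sz2.
- by apply: perm_trans span1; move: p2; clear; move=> p2; perm_count.
- by rewrite -size_eq0 sz2.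
have vs : v \in rho2 by rewrite (perm_mem p2) mem_head.
have ls : last v sigma \in rho2 by rewrite (perm_mem p2) mem_last.
(* The arcs leaving and entering [pi] along the old closed path attach [rho2] to [c']. They fall
   short only if [pi] and [s] are single vertices; then [q != q'], and one of the old attachments
   [x], [x'], still in [c'], takes over. *)
case: (eqVneq (last b pi) b) => [lb|nlb]; last first.
  exists (last b pi), b, v, (last v sigma); split; split=> //.
  rewrite sz2 => sz; apply/negP=> /eqP/esym /(uniq_last_head us) s0.
  by move: sz; rewrite /s s0.
case: (posnP (size sigma)) => [s0|s0]; last first.
  exists (last b pi), b, v, (last v sigma); split; split=> //.
    by rewrite sz2 /s /= => [[E0]]; rewrite E0 in s0.
  rewrite sz2 => sz; apply/negP=> /eqP/esym /(uniq_last_head us) s1.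
  by move: s0; rewrite s1.
have pi0 : pi = [::].
  by apply: (@uniq_last_head _ b) => //; move: ups; rewrite cat_uniq => /andP[].
move/size0nil: s0 => s0; rewrite /= s0 /= in rub ls; rewrite pi0 /= in rav.
have rhoE p : p \in rho -> p = b \/ p = v.
  by rewrite (perm_mem prs) pi0 /s s0 !inE => /orP[] /eqP; [left|right].
have nqq : q != q' by apply: n2; rewrite szrho pi0 /s s0.
have br : b \in rho by rewrite (perm_mem prs) mem_head.
have szr2 : size rho2 = 1 by rewrite sz2 /s s0.
case: (rhoE q qr) => [qb|qv].
  have q'v : q' = v by case: (rhoE q' q'r) => // q'b; rewrite qb q'b eqxx in nqq.
  exists b, x', v, v; split; split=> //; rewrite ?szr2 //.
  - by apply: adjc' => //; apply/orP; right; apply/hasP; exists q'.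
  - by rewrite -q'v.
  - by rewrite eq_sym dcr.
exists x, b, v, v; split; split=> //; rewrite ?szr2 //.
- by apply: adjc' => //; apply/orP; left; apply/hasP; exists q.
- by rewrite -qv.
- by rewrite dcr.
Qed.

(** * Families of maximal coverage *)

Lemma rot_to_last (s : seq V) x : x \in s -> exists j v p, rot j s = v :: p /\ last v p = x.
Proof.
case/mem_split=> s1 [s2 Es]; exists (size (s1 ++ [:: x])).
have -> : rot (size (s1 ++ [:: x])) s = s2 ++ s1 ++ [:: x] by rewrite Es rot_size_cat.
by case: s2 {Es} => [|v p]; [case: s1 => [|v p] | ]; do 2 eexists; split;
    rewrite //= ?last_cat //= last_cat.
Qed.

Lemma perm_rem_cons (x : V) s : x \in s -> exists s', perm_eq (x :: s') s.
Proof. by move=> /perm_to_rem; exists (rem x s); rewrite perm_sym. Qed.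

Lemma flatten_mem_split (fs : seq (seq V)) x : x \in flatten fs ->
  exists c E, perm_eq (c :: E) fs /\ x \in c.
Proof.
case/flattenP=> c /perm_to_rem cfs xc.
by exists c, (rem c fs); rewrite perm_sym.
Qed.

(* In a family of maximal coverage, a longest path of the remainder [t] spans a cycle
   or a vertex [rho], and [rho] is all of [t]. *)
Lemma factor_of_family K fs t : 0 < K -> size fs = K -> all long_cycle fs ->
  perm_eq (flatten fs ++ t) U -> cycle_factor K \/ cycle_factor K.-1.
Proof.
move=> K0 szfs0 lfs0 span0; apply: NNPP => /not_or_and[nK nK1].
pose Q m := exists fs t, [/\ size fs = K, all long_cycle fs,
  perm_eq (flatten fs ++ t) U & size (flatten fs) = m].
have Qub m : Q m -> m <= size U.
  by case=> [fs' [t' [_ _ span' <-]]]; rewrite -(perm_size span') size_cat leq_addr.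
have Q0 : Q (size (flatten fs)) by exists fs, t.
have [m {szfs0 lfs0 span0 Q0 Qub} [{}fs [{}t [szfs lfs span szm]]] mmax] := max_exists Q0 Qub.
have tmin fs' t' : size fs' = K -> all long_cycle fs' ->
    perm_eq (flatten fs' ++ t') U -> size t <= size t'.
  move=> szf' lf' span'.
  have lem : size (flatten fs') <= m by apply: mmax; exists fs', t'.
  by move: lem (perm_size span) (perm_size span'); rewrite !size_cat -szm; clear; lia.
have noins v a t' : perm_eq ((v :: a) ++ t') t -> sorted r (v :: a) ->
    ind (flatten fs) v + outd (flatten fs) (last v a) <= size (flatten fs).
  move=> pt sa; rewrite leqNgt; apply/negP=> /(insert_path lfs sa)[c [fs' [sz lc lfs' _ pe]]].
  have : size t <= size t'.
    apply: (tmin (c :: fs')); rewrite /= ?sz ?lc //; apply: perm_trans span.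
    by rewrite /= -catA; move: pe pt; clear; move=> pe pt; perm_count.
  by rewrite -(perm_size pt) size_cat /=; clear; lia.
have tn : t != [::].
  by apply/eqP=> t0; apply: nK; exists fs; split=> //; move: span; rewrite t0 cats0.
pose Q' m := exists v a t', [/\ perm_eq ((v :: a) ++ t') t, sorted r (v :: a) & size a = m].
have Qub m' : Q' m' -> m' <= size t.
  by case=> [v [a [t' [pt _ <-]]]]; rewrite -(perm_size pt) size_cat /=; clear; lia.
have Q0 : exists m', Q' m'.
  have [x [t0 Et]] : exists x t0, t = x :: t0 by case: (t) tn => // x t0; exists x, t0.
  by exists 0, x, [::], t0; rewrite Et; split.
case: Q0 => m0 Q0.
have [m' {Q0 Qub} [v [a [t' [pt sa sza]]]] amax] := max_exists Q0 Qub.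
have {amax} pmax v1 a1 t1 : perm_eq ((v1 :: a1) ++ t1) t -> sorted r (v1 :: a1) -> size a1 <=
    size a.
  by move=> p1 s1; rewrite sza; apply: amax; exists v1, a1, t1.
have uall : uniq (flatten fs ++ t) by rewrite (perm_uniq span).
have ut : uniq t by move: uall; rewrite cat_uniq => /and3P[].
set s := v :: a in pt sa.
have us : uniq s by move: ut; rewrite -(perm_uniq pt) cat_uniq => /and3P[].
have spans : perm_eq (flatten fs ++ s ++ t') U.
  by apply: perm_trans span; move: pt; clear; move=> pt; perm_count.
have maxl v1 p : perm_eq (v1 :: p) s -> sorted r (v1 :: p) ->
    outd t' (last v1 p) = 0 /\ ind t' v1 = 0.
  move=> ps sp; split.
    apply: outd_has; apply/hasPn=> y /perm_rem_cons[t1 pt1]; apply/negP=> ry.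
    have : size (p ++ [:: y]) <= size a.
      apply: (pmax v1 _ t1); last by rewrite -cat_cons sorted_catE sp /= ry.
      by rewrite -/s in pt; move: pt ps pt1; clear; move=> pt ps pt1; perm_count.
    by rewrite size_cat; have := perm_size ps; rewrite /s /=; clear; lia.
  apply: ind_has; apply/hasPn=> y /perm_rem_cons[t1 pt1]; apply/negP=> ry.
  have : size (v1 :: p) <= size a.
    apply: (pmax y _ t1); last by move: sp => /= ->; rewrite andbT.
    by rewrite -/s in pt; move: pt ps pt1; clear; move=> pt ps pt1; perm_count.
  by have := perm_size ps; rewrite /s /=; clear; lia.
have h1 v1 p : perm_eq (v1 :: p) s -> sorted r (v1 :: p) -> last v1 p != v1 ->
    r (last v1 p) v1 \/ size s <= outd s (last v1 p) + ind s v1.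
  move=> ps sp nl; case: (boolP (r _ _)) => [|nr]; [by left|right].
  have [o0 i0] := maxl _ _ ps sp.
  have := woodallE spans nl nr; rewrite !outd_cat !ind_cat !size_cat o0 i0.
  have : ind (flatten fs) v1 + outd (flatten fs) (last v1 p) <= size (flatten fs).
    by apply: (noins _ _ t') => //; move: ps pt; clear; move=> ps pt; perm_count.
  by clear; lia.
have h2 v1 a1 y b : perm_eq ((v1 :: a1) ++ y :: b) s -> sorted r ((v1 :: a1) ++ y :: b) ->
    r (last y b) y -> last v1 a1 != v1 ->
    r (last v1 a1) v1 \/ size s <= outd s (last v1 a1) + ind s v1.
  move=> ps sp _ nl; case: (boolP (r _ _)) => [|nr]; [by left|right].
  have [_ i0] := maxl v1 (a1 ++ y :: b) ps sp.
  have sa1 : sorted r (v1 :: a1) by move: sp; rewrite sorted_catE => /andP[].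
  have := woodallE spans nl nr; rewrite !outd_cat !ind_cat !size_cat i0.
  have : ind (flatten fs) v1 + outd (flatten fs) (last v1 a1) <= size (flatten fs).
    by apply: (noins _ _ ((y :: b) ++ t')) => //; move: ps pt; clear; move=> ps pt; perm_count.
  have : outd t' (last v1 a1) <= size t' by exact: count_size.
  by clear; lia.
have [rho prho trho] := hamiltonian r_irr h1 h2 us (perm_refl s) sa.
have szrho := perm_size prho.
have rotl q : q \in rho -> exists v1 p, [/\ perm_eq (v1 :: p) rho, sorted r (v1 :: p) & last
    v1 p = q].
  case/rot_to_last=> j [v1 [p [E lp]]]; exists v1, p; rewrite -E perm_rot; split=> //.
  by apply: traceable_cycle_sorted; rewrite traceable_cycle_rot.
have rotf q : q \in rho -> exists p, perm_eq (q :: p) rho /\ sorted r (q :: p).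
  case/rot_to=> j p E; exists p; rewrite -E perm_rot; split=> //.
  by apply: traceable_cycle_sorted; rewrite traceable_cycle_rot.
(* Each vertex of [rho] begins and ends a longest path, so a vertex [y] left in [t'] is not adjacent
   to [rho]. Neither [q] nor [y] can be inserted into [fs], so their two degree sums are together
   too small. *)
have t'0 : t' = [::].
  case: t' pt spans maxl => // y t1 pt spans maxl.
  have [q qr] : exists q, q \in rho by exists v; rewrite (perm_mem prho) mem_head.
  have qs : q \in s by rewrite -(perm_mem prho).
  have oq : outd (y :: t1) q = 0.
    have [v1 [p [pp sp <-]]] := rotl q qr.
    by have [] := maxl v1 p (perm_trans pp prho) sp.
  have iq : ind (y :: t1) q = 0.
    have [p [pp sp]] := rotf q qr.
    by have [] := maxl q p (perm_trans pp prho) sp.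
  have nqy : ~~ r q y by move: oq; rewrite /outd /=; case: (r q y).
  have nyq : ~~ r y q by move: iq; rewrite /ind /=; case: (r y q).
  have qy : q != y.
    apply/eqP=> qy; move: ut; rewrite -(perm_uniq pt) cat_uniq => /and3P[_ /hasP[]].
    by exists y; rewrite ?mem_head //= -qy.
  have := woodallE spans qy nqy; rewrite eq_sym in qy.
  have := woodallE spans qy nyq; rewrite !outd_cat !ind_cat !size_cat oq iq.
  have nsub z s1 s2 : perm_eq (s1 ++ s2) t -> z \in s1 ->
      ind (flatten fs) z + outd (flatten fs) z <= size (flatten fs).
    move=> p12 /perm_rem_cons[s3 p3]; apply: (noins z [::] (s3 ++ s2)) => //.
    by move: p12 p3; clear; move=> p12 p3; perm_count.
  have := nsub q s _ pt qs.
  have pt2 : perm_eq ((y :: t1) ++ s) t by move: pt; clear; move=> pt; perm_count.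
  have := nsub y (y :: t1) _ pt2 (mem_head _ _).
  have : outd s y = 0.
    apply: outd_has; apply/hasPn=> z; rewrite -(perm_mem prho) => /rotf[p [pp sp]].
    have [_ /eqP] := maxl z p (perm_trans pp prho) sp.
    by rewrite -leqn0 leqNgt -has_count -all_predC => /allP /(_ y (mem_head _ _)).
  have : ind s y = 0.
    apply: ind_has; apply/hasPn=> z; rewrite -(perm_mem prho) => /rotl[v1 [p [pp sp <-]]].
    have [/eqP + _] := maxl v1 p (perm_trans pp prho) sp.
    by rewrite -leqn0 leqNgt -has_count -all_predC => /allP /(_ y (mem_head _ _)).
  have := outd_lt r_irr qs; have := ind_lt r_irr qs.
  have := outd_lt r_irr (mem_head y t1); have := ind_lt r_irr (mem_head y t1).
  by clear; lia.
rewrite t'0 !cats0 in pt spans.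
have ptr : perm_eq rho t by exact: perm_trans pt.
have spanr : perm_eq (flatten fs ++ rho) U.
  by apply: perm_trans span; rewrite perm_cat2l.
have szt : size t = size rho by rewrite (perm_size ptr).
(* Without arcs from [rho] to the family, a vertex of [rho] and one of the family would have degree
   sum at most [size U - 2]. *)
have [q' [beta [q'r betaf rqb]]] : exists q' beta, [/\ q' \in rho, beta \in flatten fs & r q' beta].
  apply: NNPP => no.
  have vr : v \in rho by rewrite (perm_mem prho) mem_head.
  have [x xf] : exists x, x \in flatten fs.
    by move: szfs lfs K0; case: (fs) => [<-|[|x c] E] // _ _ _; exists x; rewrite mem_head.
  have nqx q y : q \in rho -> y \in flatten fs -> ~~ r q y.
    by move=> qr yf; apply/negP=> rqy; apply: no; exists q, y.
  have vx : v != x by rewrite eq_sym; apply: span_neq spanr _ _.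
  have := woodallE spanr vx (nqx _ _ vr xf); rewrite outd_cat ind_cat size_cat.
  have -> : outd (flatten fs) v = 0 by apply: outd_has; apply/hasPn=> y /(nqx _ _ vr).
  have -> : ind rho x = 0 by apply: ind_has; apply/hasPn=> q /nqx; apply.
  have := outd_lt r_irr vr; have := ind_lt r_irr xf.
  by clear; lia.
have [c0 [E [pE bc0]]] := flatten_mem_split betaf.
have [j c1 Ec] := rot_to bc0; set c := beta :: c1 in Ec.
have pc : perm_eq c c0 by rewrite -Ec perm_rot.
have := lfs; rewrite -(perm_all _ pE) /= => /andP[lc0 lE].
have lc : long_cycle c by rewrite /long_cycle -Ec size_rot rot_cycle.
have szE : (size E).+1 = K by rewrite -szfs -(perm_size pE).
have spanc : perm_eq (c ++ flatten E ++ rho) U.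
  apply: perm_trans spanr; have := perm_flatten pE.
  by move: pc; clear; move=> pc /= pE; perm_count.
have uc : uniq c.
  by have := U_uniq; rewrite -(perm_uniq spanc) cat_uniq => /andP[].
have rn : rho != [::] by apply/eqP=> r0; rewrite r0 in q'r.
have hY : has (fun y => has (r^~ y) rho) c.
  by apply/hasP; exists beta; rewrite ?mem_head //; apply/hasP; exists q'.
(* Maximal coverage excludes the outcome of [exchange] that shrinks the remainder, so all contact
   with [rho] is at [beta]. *)
have only x : has (fun x => has (r x) rho) c -> x \in c ->
    has (r x) rho || has (r^~ x) rho -> x = beta.
  move=> hX xc tx; case: (exchange szE lc lE spanc rn trho nK hX hY).
    case=> x0 [_ only _]; rewrite (only _ xc tx) (only beta) ?mem_head //.
    by apply/orP; right; apply/hasP; exists q'.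
  case=> i [pi [sigma [c' [E' [[Er pn szE' lc' lE'] [span' _ _]]]]]].
  have : size t <= size sigma.
    by apply: (tmin (c' :: E')); rewrite //= ?lc' // -catA.
  have := size_rot i rho; rewrite Er size_cat szt.
  by case: (pi) pn => //= y pi' _; clear; lia.
(* A Hamiltonian path of [rho] ending in [q'] continues along [c] from [beta] to its predecessor
   [u]. Since [u] has no arc to [rho], this path can be inserted into [E], which leaves [K.-1]
   cycles. *)
have [v1 [p [pp sp lp]]] := rotl q' q'r.
have v1r : v1 \in rho by rewrite -(perm_mem pp) mem_head.
set u := last beta c1.
have uc' : u \in c by exact: mem_last.
have ub : u != beta.
  by apply/eqP=> /(uniq_last_head uc) c10; move: lc; rewrite /c c10.
have nu : ~~ has (r u) rho.
  apply/negP=> ru; have : u = beta.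
    by apply: only => //; [apply/hasP; exists u | rewrite ru].
  by apply/eqP.
have iq : ind c v1 <= 1.
  apply: (@leq_trans (count (pred1 beta) c)); last by rewrite count_uniq_mem ?leq_b1.
  apply: sub_in_count => x xc rx /=; apply/eqP; apply: only => //.
    by apply/hasP; exists x => //; apply/hasP; exists v1.
  by apply/orP; left; apply/hasP; exists v1.
have uv1 : u != v1 by apply: span_neq spanc _ _; rewrite ?mem_cat ?v1r ?orbT.
have := woodallE spanc uv1 (hasPn nu _ v1r).
rewrite !outd_cat !ind_cat !size_cat (outd_has nu).
have := outd_lt r_irr uc'; have := ind_lt r_irr v1r => b1 b2 b3.
have spath : sorted r ((v1 :: p) ++ c).
  rewrite sorted_catE; apply/and3P; split=> //; first by rewrite /= lp.
  by case/andP: lc => _; rewrite cycleE => /andP[].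
have lt : size (flatten E) < ind (flatten E) v1 + outd (flatten E) (last v1 (p ++ c)).
  by rewrite last_cat [last _ c]/= -/u; move: b1 b2 b3 iq; clear; lia.
case: (insert_path lE spath lt) => c2 [E2 [sz2 lc2 lE2 _ p2]].
apply: nK1; exists (c2 :: E2); rewrite /= sz2 lc2 -szE; split=> //.
apply: perm_trans spanc; move: p2 pp; clear; move=> p2 pp; perm_count.
Qed.

(** * Spanning families with one cycle too many *)

Definition one_way (c d : seq V) :=
  all (fun x => ~~ has (r x) d) c || all (fun x => ~~ has (r^~ x) d) c.

Lemma one_wayPn c d x x' y y' : one_way c d ->
  x \in c -> x' \in c -> y \in d -> y' \in d -> r x y -> r y' x' -> False.
Proof.
case/orP=> /allP no xc x'c yd y'd rxy ryx.
  by have /hasP[] := no x xc; exists y.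
by have /hasP[] := no x' x'c; exists y'.
Qed.

(** Arcs in both directions attach [d] to [c], and [dissolve] then distributes [d] over the other
    cycles. *)
Lemma one_way_blocks k c d E : (size E).+1 = k -> long_cycle c -> long_cycle d ->
  all long_cycle E -> perm_eq (c ++ d ++ flatten E) U -> ~ cycle_factor k -> one_way c d.
Proof.
move=> szE lc ld lE span nk; apply/negPn/negP; rewrite negb_or => /andP[].
case/allPn=> x xc /negPn/hasP[q qd rxq]; case/allPn=> x' x'c /negPn/hasP[q' q'd rqx].
case/andP: (ld) => szd cd; apply: nk.
apply: (dissolve (leqnn (size d)) szE lc lE) => //.
- by apply: perm_trans span; clear; perm_count.
- by case: (d) szd.
- by rewrite /traceable_cycle cd orbT.
by exists x, x', q, q'; split; split=> // sz1; rewrite sz1 in szd.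
Qed.

Lemma one_way_pairwise k fs : size fs = k.+1 -> all long_cycle fs ->
  perm_eq (flatten fs) U -> ~ cycle_factor k -> pairwise one_way fs.
Proof.
move=> sz lfs span nk.
suff gen fs1 fs2 : fs = fs1 ++ fs2 -> pairwise one_way fs2 by exact: (gen [::]).
elim: fs2 fs1 => [|c fs2 IH] fs1 //= Efs; apply/andP; split; last first.
  by apply: (IH (rcons fs1 c)); rewrite cat_rcons.
apply/allP=> d /perm_to_rem pd.
have pfs : perm_eq fs (c :: d :: fs1 ++ rem d fs2).
  by rewrite Efs; move: pd; clear; move=> pd; perm_count.
have := lfs; rewrite (perm_all _ pfs) => /= /and3P[lc ld lE].
apply: (one_way_blocks (k := k) (E := fs1 ++ rem d fs2)) => //.
  by have := perm_size pfs; rewrite sz => [[->]].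
by apply: perm_trans span; rewrite perm_sym; exact: perm_flatten pfs.
Qed.

(* The block [pi ++ kappa] is shortened to the cycle [kappa]; a neighbouring
   block, opened at an attachment to [pi], swallows [pi] and is inserted elsewhere. *)
Lemma no_shortcut k q p kappa E : 0 < k -> size E = k -> ~ cycle_factor k ->
  all long_cycle E -> long_cycle kappa -> long_cycle ((q :: p) ++ kappa) ->
  perm_eq (((q :: p) ++ kappa) ++ flatten E) U -> False.
Proof.
move=> k0 szE nk lE lkap lh span; set w := last q p.
have sp : sorted r (q :: p).
  by case/andP: lh => _; rewrite cycleE sorted_catE => /andP[/andP[]].
have [h Eh] : exists h, h = (q :: p) ++ kappa by eexists.
rewrite -Eh in lh span.
have qh : q \in h by rewrite Eh mem_head.
have wh : w \in h by rewrite Eh mem_cat mem_last.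
have ph : perm_eq h ((q :: p) ++ kappa) by rewrite Eh.
have block x : x \in flatten E -> exists (c : seq V) (E2 : seq (seq V)), [/\ x \in c, perm_eq
    (c :: E2) E,
    long_cycle c, all long_cycle E2 & one_way h c] /\
    [/\ (size E2).+1 = k & perm_eq (h ++ c ++ flatten E2) U].
  case/flatten_mem_split=> c [E2 [pE xc]]; exists c, E2.
  have := lE; rewrite -(perm_all _ pE) => /= /andP[lc lE2].
  have sz2 : (size E2).+1 = k by rewrite -szE -(perm_size pE).
  have span2 : perm_eq (h ++ c ++ flatten E2) U.
    by apply: perm_trans span; rewrite perm_cat2l; exact: perm_flatten pE.
  by split; split=> //; exact: one_way_blocks span2 nk.
have uq x y (c : seq V) E2 : perm_eq (h ++ c ++ flatten E2) U -> x \in h -> y \in c -> x != y.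
  by move=> sp2 xh yc; apply: span_neq sp2 xh _; rewrite mem_cat yc.
(* [kappa] stays a cycle of its own; a path through [c] and the cut-off segment, inserted into [E2],
   makes [k] cycles in all. *)
have close (c : seq V) E2 v s : perm_eq (h ++ c ++ flatten E2) U -> (size E2).+1 = k ->
    all long_cycle E2 -> perm_eq (v :: s) (c ++ q :: p) -> sorted r (v :: s) ->
    size (flatten E2) < ind (flatten E2) v + outd (flatten E2) (last v s) -> False.
  move=> span2 sz2 lE2 ps ss lt.
  have [c' [E' [sz' lc' lE' _ p']]] := insert_path lE2 ss lt.
  apply: nk; exists (kappa :: c' :: E'); rewrite /= sz' lkap lc'; split=> //.
  by apply: perm_trans span2; move: p' ps ph; clear; move=> p' ps ph; perm_count.
have [x xf] : exists x, x \in flatten E.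
  by move: szE k0 lE; case: (E) => [<-|[|x c] E'] // _ _ _; exists x; rewrite mem_head.
(* Otherwise take [x] in another cycle. By one-wayness it has no arc to [h] or none from [h], and
   its degree sum with [q] or with [w] is too small. *)
have [[beta [betaf rwb]]|[gamma [gammaf rgq]]] :
    (exists y, y \in flatten E /\ r w y) \/ (exists y, y \in flatten E /\ r y q).
- apply: NNPP => /not_or_and[nw nq].
  have now y : y \in flatten E -> ~~ r w y by move=> yf; apply/negP=> ryw; apply: nw; exists y.
  have noq y : y \in flatten E -> ~~ r y q by move=> yf; apply/negP=> ryw; apply: nq; exists y.
  have := woodallE span (_ : w != x) (now x xf).
  rewrite (span_neq span) // => /(_ isT); rewrite outd_cat ind_cat size_cat.
  have := woodallE span (_ : x != q) (noq x xf).
  rewrite eq_sym (span_neq span) // => /(_ isT); rewrite outd_cat ind_cat size_cat.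
  rewrite (outd_has (s := flatten E) (u := w)); last by apply/hasPn.
  rewrite (ind_has (s := flatten E) (v := q)); last by apply/hasPn.
  have [c [E2 [[xc _ _ _ ow] _]]] := block x xf.
  have [->|->] : outd h x = 0 \/ ind h x = 0.
    case: (boolP (has (r x) h)) => [/hasP[y yh rxy]|]; last by left; exact: outd_has.
    right; apply: ind_has; apply/hasPn=> z zh; apply/negP=> rzx.
    exact: (one_wayPn ow zh yh xc xc).
  + have := outd_lt r_irr xf; have := ind_lt r_irr qh; clear; lia.
  + have := ind_lt r_irr xf; have := outd_lt r_irr wh; clear; lia.
- have [c [E2 [[bc pE lc lE2 ow] [sz2 span2]]]] := block _ betaf.
  have [j c1 Ec] := rot_to bc; set u := last beta c1.
  have pc : perm_eq c (beta :: c1) by rewrite -Ec perm_sym perm_rot.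
  have uc : u \in c by rewrite (perm_mem pc) mem_last.
  have pureu y z : y \in h -> z \in c -> ~~ r z y.
    by move=> yh zc; apply/negP=> rzy; exact: (one_wayPn ow wh yh bc zc).
  apply: (close c E2 q (p ++ beta :: c1)) => //.
  + by move: pc; clear; move=> pc; perm_count.
  + rewrite -cat_cons sorted_catE; apply/and3P; split=> //.
    by move: lc; rewrite /long_cycle -(rot_cycle j) Ec cycleE => /andP[_ /andP[]].
  (* Arcs between [h] and [c] all leave [h], so within [h] and [c] the ends [u] and [q] have degree
     sum at most [size h + size c - 2]. The rest falls on [E2]. *)
  have := woodallE span2 (_ : u != q) (pureu q u qh uc).
  rewrite eq_sym (uq _ _ c E2) // => /(_ isT); rewrite !outd_cat !ind_cat !size_cat.
  rewrite (outd_has (s := h) (u := u)); last by apply/hasPn=> y yh; exact: pureu.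
  rewrite (ind_has (s := c) (v := q)); last by apply/hasPn=> y yc; exact: pureu.
  have := outd_lt r_irr uc; have := ind_lt r_irr qh.
  by rewrite last_cat [last _ (beta :: c1)]/= -/u; clear; lia.
have [c [E2 [[gc pE lc lE2 ow] [sz2 span2]]]] := block _ gammaf.
have [j [v [c1 [Ec lg]]]] := rot_to_last gc.
have pc : perm_eq c (v :: c1) by rewrite -Ec perm_sym perm_rot.
have vc : v \in c by rewrite (perm_mem pc) mem_head.
have purew y z : y \in h -> z \in c -> ~~ r y z.
  by move=> yh zc; apply/negP=> rzy; exact: (one_wayPn ow yh qh zc gc).
apply: (close c E2 v (c1 ++ q :: p)) => //.
- by move: pc; clear; move=> pc; perm_count.
- rewrite -cat_cons sorted_catE; apply/and3P; split=> //; last by rewrite /= lg.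
  by move: lc; rewrite /long_cycle -(rot_cycle j) Ec cycleE => /andP[_ /andP[]].
have := woodallE span2 (uq _ _ c E2 span2 wh vc) (purew w v wh vc).
rewrite !outd_cat !ind_cat !size_cat.
rewrite (outd_has (s := c) (u := w)); last by apply/hasPn=> y yc; exact: purew.
rewrite (ind_has (s := h) (v := v)); last by apply/hasPn=> y yh; exact: purew.
have := ind_lt r_irr vc; have := outd_lt r_irr wh.
by rewrite last_cat [last _ (q :: p)]/= -/w; clear; lia.
Qed.

(** The vertices of [m] are not cyclic neighbours of [x]. A chord in either direction thus leaves a
    cycle of length at least 3, against [no_shortcut]. *)
Lemma no_chord k x y m z E v : 0 < k -> size E = k -> ~ cycle_factor k ->
  all long_cycle E -> cycle r (x :: y :: m ++ [:: z]) ->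
  perm_eq ((x :: y :: m ++ [:: z]) ++ flatten E) U -> v \in m -> ~~ r x v && ~~ r v x.
Proof.
move=> k0 szE nk lE ch span vm; case/splitPr: vm ch span => m1 m2 ch span.
have long (c : seq V) : 2 < size c -> sorted r c -> lk r c c -> long_cycle c.
  by move=> sz s l; rewrite /long_cycle sz cycleE s.
have split1 : cycle r ([:: x] ++ (y :: m1) ++ (v :: m2 ++ [:: z])).
  by move: ch; rewrite /= -catA.
apply/andP; split; apply/negP=> rxv.
  apply: (@no_shortcut k y m1 ((v :: m2 ++ [:: z]) ++ [:: x]) E) => //.
  - apply: long; first by rewrite /= !size_cat /=; clear; lia.
      move: split1; rewrite cycle_catC -catA cycleE => /andP[+ _].
      by rewrite sorted_catE => /and3P[].
    by rewrite lk_catl.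
  - apply/andP; split; first by rewrite /= !size_cat /= !size_cat /=; clear; lia.
    by move: split1; rewrite cycle_catC -catA.
  - by apply: perm_trans span; clear; perm_count.
have nz : m2 ++ [:: z] != [::] by case: (m2).
case Ez : (m2 ++ [:: z]) nz => [|q p] // _.
have {}split1 : cycle r ((x :: y :: m1 ++ [:: v]) ++ (q :: p)).
  by move: split1; rewrite Ez /= -catA.
apply: (@no_shortcut k q p (x :: y :: m1 ++ [:: v]) E) => //.
- apply: long; first by rewrite /= !size_cat /=; clear; lia.
    by move: split1; rewrite cycleE sorted_catE => /andP[/andP[]].
  by rewrite /= last_cat /= rxv.
- apply/andP; split; first by rewrite /= !size_cat /= !size_cat /=; clear; lia.
  by rewrite cycle_catC.
have pz : perm_eq (m2 ++ [:: z]) (q :: p) by rewrite Ez.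
by apply: perm_trans span; move: pz; clear; move=> pz; perm_count.
Qed.

(** By [no_chord], only the predecessor and the successor of [x] on [c] can be adjacent to it. *)
Lemma inner_degrees k c E x : 0 < k -> size E = k -> ~ cycle_factor k ->
  all long_cycle (c :: E) -> perm_eq (c ++ flatten E) U -> x \in c ->
  outd c x <= 2 /\ ind c x <= 2.
Proof.
move=> k0 szE nk /= /andP[/andP[szc cc] lE] span /rot_to[j c1 Ec].
have pc : perm_eq c (x :: c1) by rewrite -Ec perm_sym perm_rot.
move: cc szc; rewrite -(rot_cycle j) -(size_rot j) Ec => cc szc.
case: c1 {Ec} pc cc szc => [|y c1] //; case/lastP: c1 => [|m z] //.
rewrite -cats1 => pc cc szc.
have span2 : perm_eq ((x :: y :: m ++ [:: z]) ++ flatten E) U.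
  by apply: perm_trans span; rewrite perm_cat2r perm_sym.
have nc v vm := no_chord (v := v) k0 szE nk lE cc span2 vm.
rewrite (outd_perm _ _ pc) (ind_perm _ _ pc) /outd /ind /= !count_cat r_irr /=.
have -> : count (r x) m = 0 by apply: outd_has; apply/hasPn=> v /nc/andP[].
have -> : count (r^~ x) m = 0 by apply: ind_has; apply/hasPn=> v /nc/andP[].
by do 4 case: (r _ _).
Qed.

Lemma tight_count (P Q : pred V) (E : seq (seq V)) :
  (forall c, c \in E -> count P c + count Q c <= size c) ->
  count P (flatten E) + count Q (flatten E) <= size (flatten E) /\
  (size (flatten E) <= count P (flatten E) + count Q (flatten E) ->
   forall c, c \in E -> count P c + count Q c = size c).
Proof.
elim: E => [|c E IH] //= le; have lec := le c (mem_head _ _).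
have [|leE tE] := IH; first by move=> d dE; apply: le; rewrite inE dE orbT.
rewrite !count_cat size_cat; split; first by move: lec leE; clear; lia.
move=> ge d; rewrite inE => /predU1P[->|].
  by move: lec leE ge; clear; lia.
by apply: tE; move: lec leE ge; clear; lia.
Qed.

(* No chord joins [h0] to [h2], and by one-wayness every other block contributes at most
   its size to their degree sum; so equality holds everywhere. *)
Lemma complete_or k h0 h1 h2 h3 h' E : 0 < k -> size E = k -> ~ cycle_factor k ->
  all long_cycle ([:: h0, h1, h2, h3 & h'] :: E) ->
  perm_eq ([:: h0, h1, h2, h3 & h'] ++ flatten E) U ->
  h' = [::] /\
  forall c, c \in E -> (forall x, x \in c -> r h0 x) \/ (forall x, x \in c -> r x h2).
Proof.
set h := [:: h0, h1, h2, h3 & h'] => k0 szE nk lhE span.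
have h0h : h0 \in h by exact: mem_head.
have h2h : h2 \in h by rewrite !inE eqxx !orbT.
have [o0 _] := inner_degrees k0 szE nk lhE span h0h.
have [_ i2] := inner_degrees k0 szE nk lhE span h2h.
have /= /andP[ow _] : pairwise one_way (h :: E).
  by apply: one_way_pairwise nk; rewrite //= szE.
have uh : uniq h by have := U_uniq; rewrite -(perm_uniq span) cat_uniq => /andP[].
have n02 : h0 != h2 by move: uh; rewrite /= !inE !negb_or => /andP[/and3P[]].
have nr : ~~ r h0 h2.
  case Ez : _ / (lastP (h3 :: h')) => [|m z] //.
  have Eh : h = h0 :: h1 :: (h2 :: m) ++ [:: z] by rewrite /h Ez -cats1.
  move: lhE; rewrite /= => /andP[/andP[_ ch] lE].
  rewrite -/h Eh in ch; rewrite Eh in span.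
  by have /andP[] := no_chord k0 szE nk lE ch span (mem_head h2 m).
have le c : c \in E -> count (r h0) c + count (r^~ h2) c <= size c.
  move=> cE; case/orP: (allP ow _ cE) => /allP no.
    by rewrite -/(outd c h0) (outd_has (no _ h0h)) count_size.
  by rewrite -/(ind c h2) (ind_has (no _ h2h)) addn0 count_size.
have [sum tight] := tight_count le.
have := woodallE span n02 nr; rewrite outd_cat ind_cat size_cat => w.
(* The degree sum is at most [2 + 2 + size (flatten E)], so [h] has just 4 vertices and every other
   cycle contributes exactly its size. *)
split.
  apply/nilP; rewrite /nilp; move: w sum o0 i2.
  by rewrite /h /= /outd /ind; clear; lia.
move=> c cE.
have eqc : outd c h0 + ind c h2 = size c.
  by apply: tight => //; move: w sum o0 i2; rewrite {1}/h /= /outd /ind; clear; lia.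
case: (boolP (has (r h0) c)) => [/hasP[y yc ry]|no0]; [left | right].
  have i0 : ind c h2 = 0.
    apply: ind_has; apply/hasPn=> z zc; apply/negP=> rz.
    exact: (one_wayPn (allP ow _ cE) h0h h2h yc zc).
  by move/eqP: eqc; rewrite i0 addn0 -all_count => /allP.
by move/eqP: eqc; rewrite (outd_has no0) -all_count => /allP.
Qed.

(** [complete_or] is applied to all four rotations of [h]; answers in different directions would
    contradict one-wayness. *)
Lemma complete_blocks k h E : 0 < k -> size E = k -> ~ cycle_factor k ->
  all long_cycle (h :: E) -> perm_eq (h ++ flatten E) U -> 3 < size h ->
  size h = 4 /\
  forall c, c \in E -> (forall y x, y \in h -> x \in c -> r y x) \/
                       (forall y x, y \in h -> x \in c -> r x y).
Proof.
move=> k0 szE nk lhE span.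
case: h lhE span => [|h0 [|h1 [|h2 [|h3 h']]]] // lhE span _.
have [h'0 c0] := complete_or k0 szE nk lhE span.
rewrite {h'}h'0 in lhE span *; split=> // c cE.
set h := [:: h0; h1; h2; h3] in lhE span *.
have /= /andP[ow _] : pairwise one_way (h :: E).
  by apply: one_way_pairwise nk; rewrite //= szE.
have rotE h' j : rot j h = h' ->
    all long_cycle (h' :: E) /\ perm_eq (h' ++ flatten E) U.
  move=> <-; split; last by apply: perm_trans span; rewrite perm_cat2r perm_rot.
  by move: lhE; rewrite /= /long_cycle size_rot rot_cycle.
have [l1 s1] := rotE [:: h1; h2; h3; h0] 1 erefl.
have [l2 s2] := rotE [:: h2; h3; h0; h1] 2 erefl.
have [l3 s3] := rotE [:: h3; h0; h1; h2] 3 erefl.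
have [_ c1] := complete_or k0 szE nk l1 s1.
have [_ c2] := complete_or k0 szE nk l2 s2.
have [_ c3] := complete_or k0 szE nk l3 s3.
have [x0 x0c] : exists x0, x0 \in c.
  case/andP: lhE => _ /allP /(_ c cE) /andP[+ _].
  by case: (c) => // x s _; exists x; exact: mem_head.
have mixed y y' x x' : y \in h -> y' \in h -> x \in c -> x' \in c -> r y x -> r x' y' -> False.
  exact: one_wayPn (allP ow _ cE).
have [i0 i1 i2 i3] : [/\ h0 \in h, h1 \in h, h2 \in h & h3 \in h].
  by rewrite !inE !eqxx !orbT.
case: (c0 c cE) (c1 c cE) (c2 c cE) (c3 c cE) => a0 [] a1 [] a2 [] a3;
  try by case: (mixed _ _ _ _ _ _ x0c x0c (a0 _ x0c) (a1 _ x0c)).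
all: try by case: (mixed _ _ _ _ _ _ x0c x0c (a0 _ x0c) (a2 _ x0c)).
all: try by case: (mixed _ _ _ _ _ _ x0c x0c (a0 _ x0c) (a3 _ x0c)).
all: try by case: (mixed _ _ _ _ _ _ x0c x0c (a1 _ x0c) (a0 _ x0c)).
all: try by case: (mixed _ _ _ _ _ _ x0c x0c (a2 _ x0c) (a0 _ x0c)).
all: try by case: (mixed _ _ _ _ _ _ x0c x0c (a3 _ x0c) (a0 _ x0c)).
- by left=> y x; rewrite !inE => /or4P[] /eqP-> xc; auto.
- by right=> y x; rewrite !inE => /or4P[] /eqP-> xc; auto.
Qed.

(** * Counting arcs between cycles *)

Definition arcs (c d : seq V) := \sum_(u <- c) outd d u.

Lemma arcs_catl c c' d : arcs (c ++ c') d = arcs c d + arcs c' d.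
Proof. by rewrite /arcs big_cat. Qed.

Lemma arcs_catr c d d' : arcs c (d ++ d') = arcs c d + arcs c d'.
Proof. by rewrite /arcs -big_split; apply: eq_bigr => u _; rewrite outd_cat. Qed.

Lemma arcs_ind c d : arcs c d = \sum_(v <- d) ind c v.
Proof.
elim: c => [|u c IH]; first by rewrite /arcs big_nil big1 // => v _.
rewrite /arcs big_cons -/(arcs c d) IH.
have -> : outd d u = \sum_(v <- d) r u v.
  by elim: d {IH} => [|v d IH]; rewrite ?big_nil // big_cons -IH.
by rewrite -big_split.
Qed.

Lemma sum_le_size (s : seq V) (F : V -> nat) b :
  (forall u, u \in s -> F u <= b) -> \sum_(u <- s) F u <= size s * b.
Proof.
elim: s => [|u s IH] le; first by rewrite big_nil.
rewrite big_cons /= mulSn leq_add ?le ?mem_head // IH // => v vs.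
by apply: le; rewrite inE vs orbT.
Qed.

Lemma sum_ge_size (s : seq V) (F : V -> nat) b :
  (forall u, u \in s -> b <= F u) -> size s * b <= \sum_(u <- s) F u.
Proof.
elim: s => [|u s IH] le; first by rewrite big_nil.
rewrite big_cons /= mulSn leq_add ?le ?mem_head // IH // => v vs.
by apply: le; rewrite inE vs orbT.
Qed.

Lemma arcs_one_way c d : one_way c d -> arcs c d + arcs d c <= size c * size d.
Proof.
case/orP=> /allP no.
  have -> : arcs c d = 0.
    by rewrite /arcs big_seq big1 // => u /no; exact: outd_has.
  by rewrite mulnC; apply: sum_le_size => u _; exact: count_size.
have -> : arcs d c = 0.
  by rewrite arcs_ind big_seq big1 // => u /no; exact: ind_has.
by rewrite addn0; apply: sum_le_size => u _; exact: count_size.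
Qed.

(** A vertex has at most two arcs inside its cycle, and a pair of vertices from different cycles
    carries at most one. The factor 2 avoids halving the square. *)
Lemma arcs_inside (Bs : seq (seq V)) : pairwise one_way Bs ->
  (forall c u, c \in Bs -> u \in c -> outd c u <= 2) ->
  2 * arcs (flatten Bs) (flatten Bs) <= size (flatten Bs) ^ 2 + 4 * size (flatten Bs).
Proof.
elim: Bs => [|c Bs IH] /=; first by rewrite /arcs big_nil.
move=> /andP[ow pw] in2.
have {IH}le1 := IH pw (fun d u dB => in2 d u (@mem_behead _ (c :: Bs) d dB)).
have le2 : arcs c c <= size c * 2.
  by apply: sum_le_size => u; apply: in2; exact: mem_head.
have le3 : arcs c (flatten Bs) + arcs (flatten Bs) c <= size c * size (flatten Bs).
  elim: Bs ow {pw in2 le1} => [|d Bs IH] /=.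
    by move=> _; rewrite /arcs big_nil big1.
  move=> /andP[/arcs_one_way ow /IH]; rewrite arcs_catl arcs_catr size_cat mulnDr.
  by move: ow; clear; lia.
rewrite !(arcs_catl, arcs_catr) size_cat -!mulnn; move: le1 le2 le3; rewrite -mulnn.
by move: (arcs _ _) (arcs _ _) (arcs _ _) (arcs _ _) (size _) (size _); clear; nia.
Qed.

(** Without two disjoint arcs, a vertex with two out-neighbours in [d] emits all the arcs, at most
    [size d]. If there is none, there are at most [size c] arcs. Both sizes are at least 3. *)
Lemma arcs_matching1 c d : uniq d -> 2 < size c -> 2 < size d ->
  (forall u1 u2 v1 v2, u1 \in c -> u2 \in c -> v1 \in d -> v2 \in d ->
     r u1 v1 -> r u2 v2 -> u1 != u2 -> v1 != v2 -> False) -> uniq c ->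
  3 * arcs c d <= size c * size d.
Proof.
move=> ud szc szd nm uc; case: (boolP (has (fun u => 1 < outd d u) c)) => [/hasP[u uc' lt]|no].
  have other u' v' : u' \in c -> u' != u -> v' \in d -> ~~ r u' v'.
    move=> u'c nu v'd; apply/negP=> ruv.
    have : ~~ has (predI (r u) (predC1 v')) d.
      apply/hasPn=> v vd; apply/negP=> /andP[/= ruv1 nv].
      by apply: (nm u u' v v') => //; rewrite eq_sym.
    move=> none; move: lt; rewrite ltnNge => /negP; apply.
    apply: (@leq_trans (count (pred1 v') d)); last by rewrite count_uniq_mem ?leq_b1.
    apply: sub_in_count => v vd rv /=; apply/negPn/negP=> nv.
    by move/hasPn/(_ v vd): none => /=; rewrite rv nv.
  have : arcs c d <= size d.
    rewrite /arcs (perm_big _ (perm_to_rem uc')) big_cons big_seq big1 /=.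
      by rewrite addn0 count_size.
    move=> u'; rewrite mem_rem_uniq // !inE => /andP[nu u'c].
    by apply: outd_has; apply/hasPn=> v'; exact: other.
  by move: szc; clear; nia.
have : arcs c d <= size c * 1.
  by apply: sum_le_size => u uc'; rewrite leqNgt; exact: (hasPn no).
by move: szd; clear; nia.
Qed.

Lemma arcs_between (Bs As : seq (seq V)) :
  (forall c d, c \in Bs -> d \in As -> 3 * arcs c d <= size c * size d) ->
  3 * arcs (flatten Bs) (flatten As) <= size (flatten Bs) * size (flatten As).
Proof.
elim: Bs => [|c Bs IH] le /=; first by rewrite /arcs big_nil.
have {IH}le1 := IH (fun d c' dB cA => le d c' (@mem_behead _ (c :: Bs) d dB) cA).
rewrite arcs_catl size_cat mulnDr mulnDl leq_add //.
have {le} := fun d => le c d (mem_head c Bs).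
elim: As {le1} => [|d As IH] led /=.
  by rewrite /arcs big1.
rewrite arcs_catr size_cat !mulnDr; apply: leq_add; first by apply: led; exact: mem_head.
apply: IH => d' dA; by apply: led; rewrite inE dA orbT.
Qed.

Lemma drop_one_cycle k fs : 0 < k -> size fs = k.+1 -> all long_cycle fs ->
  perm_eq (flatten fs) U -> 3 * k.+1 < size U -> cycle_factor k.
Proof.
move=> k0 szfs lfs span big; apply: NNPP => nk.
have [h hfs szh] : exists2 h, h \in fs & 3 < size h.
  apply: NNPP => no; move: big; rewrite ltnNge => /negP; apply.
  rewrite -(perm_size span) -szfs mulnC.
  have {no}: forall c, c \in fs -> size c <= 3.
    by move=> c cfs; rewrite leqNgt; apply/negP=> lt; apply: no; exists c.
  elim: (fs) => [|c fs' IH] //= le; rewrite size_cat mulSn leq_add ?le ?mem_head // IH // => d dfs.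
  by apply: le; rewrite inE dfs orbT.
have /perm_to_rem := hfs; set E := rem h fs => pE.
have szE : size E = k by have := perm_size pE; rewrite szfs => [[->]].
have lE : all long_cycle (h :: E) by rewrite -(perm_all _ pE).
have spanE : perm_eq (h ++ flatten E) U.
  by apply: perm_trans span; rewrite perm_sym; exact: perm_flatten pE.
have [szh4 comp] := complete_blocks k0 szE nk lE spanE szh.
(* [Bs] collects the cycles dominated by [h], [As] those that dominate it. *)
have [Bs [As [pBA hB hA]]] : exists Bs As, [/\ perm_eq (Bs ++ As) E,
    forall c y x, c \in Bs -> y \in h -> x \in c -> r y x &
    forall c y x, c \in As -> y \in h -> x \in c -> r x y].
  pose P c := all (fun y => all (r y) c) h.
  exists [seq c <- E | P c], [seq c <- E | predC P c]; split.
  - exact/permPl/perm_filterC.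
  - by move=> c y x; rewrite mem_filter => /andP[/allP Pc _] yh; apply/allP; exact: Pc.
  move=> c y x; rewrite mem_filter => /andP[/= nP cE].
  case: (comp c cE) => [all_r|]; last exact.
  by case/negP: nP; apply/allP=> y' y'h; apply/allP=> x' x'c; exact: all_r.
have pfs : perm_eq fs (h :: Bs ++ As).
  by apply: perm_trans pE _; rewrite perm_cons perm_sym.
have szBA : size (Bs ++ As) = k by rewrite (perm_size pBA).
have lBA : all long_cycle (h :: Bs ++ As) by rewrite -(perm_all _ pfs).
have spanF : perm_eq (flatten (h :: Bs ++ As)) U.
  by apply: perm_trans span; rewrite perm_sym; exact: perm_flatten pfs.
have spanBA : perm_eq (h ++ flatten Bs ++ flatten As) U by move: spanF; rewrite /= flatten_cat.
have /= /andP[owh pw] : pairwise one_way (h :: Bs ++ As).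
  by apply: one_way_pairwise spanF nk => //=; rewrite szBA.
have in2 c u : c \in fs -> u \in c -> outd c u <= 2 /\ ind c u <= 2.
  move=> /perm_to_rem pc uc; apply: (inner_degrees (E := rem c fs) k0 _ nk) => //.
  - by have := perm_size pc; rewrite szfs => [[->]].
  - by rewrite -(perm_all _ pc).
  by apply: perm_trans span; rewrite perm_sym; exact: perm_flatten pc.
have {comp szE lE spanE pE E pBA szh} subfs c : c \in h :: Bs ++ As -> c \in fs.
  by rewrite (perm_mem pfs).
case: h hfs szh4 hB hA pfs lBA spanF spanBA owh subfs
  => [|h0 [|h1 [|h2 [|h3 []]]]] // hfs _ hB hA pfs lBA spanF spanBA owh subfs.
set h := [:: h0; h1; h2; h3] in hfs hB hA pfs lBA spanF spanBA owh subfs.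
have h0h : h0 \in h by exact: mem_head.
have noB u : u \in flatten Bs -> ~~ has (r u) h.
  case/flattenP=> c cB uc; apply/hasPn=> y yh; apply/negP=> ruy.
  have cBA : c \in Bs ++ As by rewrite mem_cat cB.
  exact: (one_wayPn (allP owh _ cBA) h0h yh uc uc (hB c h0 u cB h0h uc) ruy).
have noA v : v \in flatten As -> ~~ has (r^~ v) h.
  case/flattenP=> c cA vc; apply/hasPn=> y yh; apply/negP=> ryv.
  have cBA : c \in Bs ++ As by rewrite mem_cat cA orbT.
  exact: (one_wayPn (allP owh _ cBA) yh h0h vc vc ryv (hA c h0 v cA h0h vc)).
have [o0 i0] := in2 h h0 hfs h0h.
(* [u] has no arc to [h], and [h0] receives none from [Bs], at most 2 from [h] and at most
   [size (flatten As)] from [As]. The 4 vertices of [h] leave a surplus of 2. *)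
have degB u : u \in flatten Bs -> size (flatten Bs) + 2 <= outd (flatten Bs) u + outd (flatten
    As) u.
  move=> uB; have nu := noB u uB.
  have uh : u != h0 by rewrite eq_sym; apply: span_neq spanBA h0h _; rewrite mem_cat uB.
  have := woodallE spanBA uh (hasPn nu _ h0h).
  rewrite !(outd_cat, ind_cat, size_cat) (outd_has nu).
  rewrite (ind_has (s := flatten Bs)); last first.
    by apply/hasPn=> u' u'B; exact: (hasPn (noB u' u'B)).
  have : ind (flatten As) h0 <= size (flatten As) by exact: count_size.
  by move: i0; rewrite [size h]/=; clear; lia.
have degA v : v \in flatten As -> size (flatten As) + 2 <= ind (flatten As) v + ind (flatten Bs) v.
  move=> vA; have nv := noA v vA.
  have hv : h0 != v by apply: span_neq spanBA h0h _; rewrite mem_cat vA orbT.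
  have := woodallE spanBA hv (hasPn nv _ h0h).
  rewrite !(outd_cat, ind_cat, size_cat) (ind_has nv).
  rewrite (outd_has (s := flatten As)); last first.
    by apply/hasPn=> v' v'A; exact: (hasPn (noA v' v'A)).
  have : outd (flatten Bs) h0 <= size (flatten Bs) by exact: count_size.
  by move: o0; rewrite [size h]/=; clear; lia.
have in2s (Cs : seq (seq V)) : {subset Cs <= Bs ++ As} ->
    forall c u, c \in Cs -> u \in c -> outd c u <= 2.
  move=> sub c u cC uc; have [] // := in2 c u _ uc.
  by apply: subfs; rewrite inE sub // orbT.
move: (pw); rewrite pairwise_cat => /and3P[_ pwB pwA].
have leB : 2 * arcs (flatten Bs) (flatten Bs) <= size (flatten Bs) ^ 2 + 4 * size (flatten Bs).
  by apply: arcs_inside pwB (in2s _ _) => c cB; rewrite mem_cat cB.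
have leA : 2 * arcs (flatten As) (flatten As) <= size (flatten As) ^ 2 + 4 * size (flatten As).
  by apply: arcs_inside pwA (in2s _ _) => c cA; rewrite mem_cat cA orbT.
have geB : size (flatten Bs) * (size (flatten Bs) + 2) <=
    arcs (flatten Bs) (flatten Bs) + arcs (flatten Bs) (flatten As).
  by rewrite -arcs_catr; apply: sum_ge_size => u /degB; rewrite outd_cat.
have geA : size (flatten As) * (size (flatten As) + 2) <=
    arcs (flatten As) (flatten As) + arcs (flatten Bs) (flatten As).
  by rewrite -arcs_catl arcs_ind; apply: sum_ge_size => u /degA; rewrite ind_cat addnC.
have uBA : uniq (h ++ flatten Bs ++ flatten As) by rewrite (perm_uniq spanBA).
have ublock c : c \in Bs ++ As -> uniq c.
  move=> /perm_to_rem /perm_flatten pc; move: uBA; rewrite -flatten_cat cat_uniq => /and3P[_ _].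
  by rewrite (perm_uniq pc) /= cat_uniq => /andP[].
have lblock c : c \in Bs ++ As -> long_cycle c.
  by move: lBA => /= /andP[_ /allP lBA] /lBA.
suff leE : 3 * arcs (flatten Bs) (flatten As) <= size (flatten Bs) * size (flatten As).
  (* By the degree bounds, the arcs from [Bs] to [As] number at least half the square of either
     size. With at most a third of the product, both sizes vanish, but [h] alone has only 4 of the
     more than 6 vertices. *)
  have : 6 < size h + (size (flatten Bs) + size (flatten As)).
    by rewrite -!size_cat (perm_size spanBA); move: big k0; clear; lia.
  move: leA leB geA geB leE; rewrite [size h]/= -!mulnn; clear.
  by move: (size _) (size _) (arcs _ _) (arcs _ _) (arcs _ _) => *; nia.
apply: arcs_between => c d cB dA.
have cBA : c \in Bs ++ As by rewrite mem_cat cB.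
have dBA : d \in Bs ++ As by rewrite mem_cat dA orbT.
have /andP[szc cyc] := lblock c cBA; have /andP[szd cyd] := lblock d dBA.
apply: arcs_matching1; rewrite ?ublock // => u1 u2 v1 v2 u1c u2c v1d v2d ruv1 ruv2 nu nv.
have /andP[_ cyh] : long_cycle h by move: lBA => /= /andP[].
have [rh01 rh23] : r h0 h1 /\ r h2 h3 by move: cyh => /= /and5P[].
(* Half of [h] continues into a piece of [c], dominated by [h], and closes up from a piece of [d],
   which dominates [h]. *)
have mk x y S T : x \in h -> y \in h -> r x y -> S != [::] -> T != [::] ->
    sorted r S -> sorted r T -> lk r S T -> {subset S <= c} -> {subset T <= d} ->
    long_cycle ([:: x; y] ++ S ++ T).
  move=> xh yh rxy S0 T0 sS sT lST subS subT; apply/andP; split.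
    by rewrite !size_cat; case: (S) S0 => //= *; rewrite !ltnS.
  have n0 : S ++ T != [::] by case: (S) S0.
  rewrite cycle_catE //; apply/and4P; split; first by rewrite /= rxy.
  - case: (S) S0 subS => // s S' _ subS /=; apply: hB cB yh _.
    by apply: subS; exact: mem_head.
  - by rewrite sorted_catE; apply/and3P.
  rewrite lk_catl //; case: (T) T0 subT => // t T' _ subT /=; apply: hA dA xh _.
  by apply: subT; exact: mem_last.
(* The disjoint arcs cut [c] after [u1] and [u2], and [d] before [v1] and [v2]; each new cycle uses
   one of these arcs. *)
have [j [v [p [Ec lp]]]] := rot_to_last u2c.
have [s1 [s2 Ep]] : exists s1 s2, v :: p = (s1 ++ [:: u1]) ++ s2.
  by apply: mem_split; rewrite -Ec mem_rot.
case: s2 Ep => [|w s2] Ep.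
  have : last u1 (v :: p) = u1 by rewrite Ep !last_cat.
  by rewrite /= lp => u21; rewrite u21 eqxx in nu.
have lw : last w s2 = u2 by rewrite -lp -[RHS]/(last v (v :: p)) Ep last_cat.
have pc : perm_eq c ((s1 ++ [:: u1]) ++ w :: s2) by rewrite -Ep -Ec perm_sym perm_rot.
have [sS1 sS2] : sorted r (s1 ++ [:: u1]) /\ sorted r (w :: s2).
  by move: cyc; rewrite -(rot_cycle j) Ec Ep cycleE sorted_catE => /andP[/and3P[]].
have [j' b Ed] := rot_to v1d.
have v2b : v2 \in b.
  have : v2 \in v1 :: b by rewrite -Ed mem_rot.
  by rewrite inE eq_sym (negbTE nv).
case/splitPr: v2b Ed => b1 b2 Ed.
have pd : perm_eq d ((v1 :: b1) ++ v2 :: b2) by rewrite -[_ ++ _]Ed perm_sym perm_rot.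
have [sT1 sT2] : sorted r (v1 :: b1) /\ sorted r (v2 :: b2).
  move: cyd; rewrite -(rot_cycle j') Ed -cat_cons cycleE sorted_catE.
  by case/andP=> /and3P[].
have pB := perm_to_rem cB; have pA := perm_to_rem dA.
have sz2 : (size (rem c Bs ++ rem d As)).+2 = k.
  by rewrite -szBA !size_cat (perm_size pB) (perm_size pA) /= addnS.
have lE2 : all long_cycle (rem c Bs ++ rem d As).
  apply/allP=> z; rewrite mem_cat => /orP[] /mem_rem zc; apply: lblock.
    by rewrite mem_cat zc.
  by rewrite mem_cat zc orbT.
apply: nk; exists (([:: h0; h1] ++ (s1 ++ [:: u1]) ++ v1 :: b1) ::
  ([:: h2; h3] ++ (w :: s2) ++ v2 :: b2) :: rem c Bs ++ rem d As).
split; [exact: sz2 | apply/and3P; split=> // | ].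
- apply: mk; rewrite ?inE ?eqxx ?orbT //; first by case: (s1).
  + by rewrite lk_catl.
  + by move=> z zs; rewrite (perm_mem pc) mem_cat zs.
  by move=> z zs; rewrite (perm_mem pd) mem_cat zs.
- apply: mk; rewrite ?inE ?eqxx ?orbT //; first by rewrite /= lw.
  + by move=> z zs; rewrite (perm_mem pc) mem_cat zs orbT.
  by move=> z zs; rewrite (perm_mem pd) mem_cat zs orbT.
apply: perm_trans spanBA; move: (perm_flatten pB) (perm_flatten pA) pc pd; rewrite /h.
by clear; move=> pB pA pc pd; perm_count.
Qed.

Lemma cycle_factor_of_packing k fs : 0 < k -> size fs = k.+1 -> all long_cycle fs ->
  uniq (flatten fs) -> {subset flatten fs <= U} -> 3 * k.+1 < size U -> cycle_factor k.
Proof.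
move=> k0 szfs lfs ufs sub big.
have span : perm_eq (flatten fs ++ [seq x <- U | x \notin flatten fs]) U.
  apply: uniq_perm => //.
    rewrite cat_uniq ufs filter_uniq // andbT; apply/hasPn=> x.
    by rewrite mem_filter => /andP[].
  by move=> x; rewrite mem_cat mem_filter; case: (boolP (x \in _)) => // /sub ->.
have [[fs' [sz' lfs' span']]|] := factor_of_family (ltn0Sn k) szfs lfs span; last exact.
exact: drop_one_cycle sz' lfs' span' big.
Qed.
End Digraph.

(** * Contracting the perfect matching *)

Section Matching.
Variables (T : finType) (e : rel T) (X : {set T}) (M : {set {set T}}) (mate : T -> T).
Hypothesis e_sym : symmetric e.
Hypothesis e_irr : irreflexive e.
Hypothesis e_bip : bipartition e X.
Hypothesis e_mate : forall v, e v (mate v).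
Hypothesis mateP : forall v w, ([set v; w] \in M) = (w == mate v).

Lemma mateK : involutive mate.
Proof. by move=> v; apply/esym/eqP; rewrite -mateP setUC mateP. Qed.

Lemma mate_neq v : mate v != v.
Proof. by apply/eqP=> mv; have := e_mate v; rewrite mv e_irr. Qed.

Lemma side_edge v w : e v w -> (w \in X) = (v \notin X).
Proof. by move/e_bip; case: (v \in X); case: (w \in X). Qed.

Lemma side_mate v : (mate v \in X) = (v \notin X).
Proof. exact: side_edge. Qed.

(** The list is read as an open path; repeating the head at the end includes the closing edge of a
    cycle. *)
Definition inner_matching_edges (s : seq T) :=
  if s is y :: s' then count id (pairmap (fun a b => b == mate a) y s') else 0.

Lemma cycle_M_edgesE y p : uniq (y :: p) ->
  cycle_M_edges M (y :: p) = inner_matching_edges (y :: rcons p y).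
Proof.
move=> u; rewrite /cycle_M_edges /inner_matching_edges.
rewrite (eq_count (a2 := fun x => next (y :: p) x == mate x)); last by move=> x; rewrite /= mateP.
rewrite -[LHS](count_map _ id); congr (count _ _).
apply: (eq_from_nth (x0 := false)); first by rewrite size_map size_pairmap size_rcons.
rewrite size_map => i lti.
rewrite (nth_map y) // (nth_pairmap y) ?size_rcons //.
rewrite next_nth mem_nth // index_uniq // -rcons_cons !nth_rcons lti.
by case: ltnP => // le; rewrite nth_default //; case: ifP.
Qed.

(** The alternating sequence that leaves each listed vertex through its matching edge. *)
Definition spread (as_ : seq T) := flatten [seq [:: a; mate a] | a <- as_].

(* Two consecutive edges of [s] never both belong to the matching. *)
Lemma inner_matching_edges_max j s : uniq s -> size s = j.*2 ->
  inner_matching_edges s <= j /\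
  (inner_matching_edges s = j -> exists as_, s = spread as_).
Proof.
elim: j s => [|j IH] [|a [|b s]] //= u sz.
  by split=> // _; exists [::].
have {}sz : size s = j.*2 by move: sz; rewrite doubleS => [[]].
have us : uniq s by case/and3P: u.
have [le eq] := IH s us sz.
(* [bit] records whether the edge following [b] is a matching edge; it defaults to false when
   nothing follows. *)
pose bit := if s is c :: _ then c == mate b else false.
have ab : (b == mate a) + bit <= 1.
  case: (b =P mate a) => [Eb|_]; last by rewrite add0n leq_b1.
  rewrite /bit; case: (s) u => // c s' /and3P[+ _ _]; rewrite Eb mateK.
  by case: (c =P a) => // ->; rewrite !inE eqxx orbT.
have sumE : count id (pairmap (fun a b => b == mate a) b s) =
    bit + inner_matching_edges s by rewrite /bit; case: (s).
rewrite sumE; split; first by move: ab le; clear; lia.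
move=> tot; have [as_ Es] : exists as_, s = spread as_ by apply: eq; move: tot ab le; clear; lia.
exists (a :: as_); rewrite Es /spread /=; congr [:: _, _ & _].
have bit0 : bit = false.
  rewrite /bit Es; case: as_ Es => //= c as_ Es; apply/eqP => cb.
  by case/and3P: u => _ + _; rewrite Es /spread /= cb mateK !inE eqxx !orbT.
by move: tot le; rewrite bit0; case: eqP => //= _; clear; lia.
Qed.

Lemma inner_rcons y p z : inner_matching_edges (y :: rcons p z) =
  inner_matching_edges (y :: p) + (z == mate (last y p)).
Proof.
rewrite /=; elim: p y => [|x p IH] y /=; first by rewrite addn0.
by rewrite IH addnA.
Qed.

(** Rotated so that its closing edge is not in [M], the cycle is an open path with the maximal
    number of matching edges, hence a [spread]. A rotation by at most one suffices, since
    consecutive edges are not both in [M]. *)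
Lemma M_cycle_spread c : M_cycle e M c ->
  exists as_, [/\ perm_eq (spread as_) c, uniq (spread as_) & cycle e (spread as_)].
Proof.
case=> /and3P[uc szc cc] half.
have rotP c' j : rot j c = c' ->
    [/\ uniq c', 2 < size c', cycle e c' & (cycle_M_edges M c').*2 = size c'].
  move=> <-; rewrite rot_uniq size_rot rot_cycle; split=> //.
  rewrite -half /cycle_M_edges; congr (_.*2).
  rewrite (eq_count (a2 := fun x => [set x; next c x] \in M)); last by move=> x; rewrite next_rot.
  by apply/permP; rewrite perm_rot.
have unwrap c' j : rot j c = c' -> (if c' is y :: p then y != mate (last y p) else true) ->
    exists as_, perm_eq (spread as_) c /\ cycle e (spread as_).
  move=> Ec; have [u sz cy h] := rotP c' j Ec; case: c' Ec u sz cy h => // y p Ec u sz cy h ny.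
  move: h; rewrite (cycle_M_edgesE u) inner_rcons (negbTE ny) addn0 => h.
  have [_ eq] := inner_matching_edges_max u (esym h).
  have [as_ E] := eq erefl; exists as_; rewrite -E; split=> //.
  by rewrite -Ec perm_rot.
suff [as_ [pe cy]] : exists as_, perm_eq (spread as_) c /\ cycle e (spread as_).
  by exists as_; rewrite pe (perm_uniq pe).
case Ec: c uc szc => [|y [|z p]] // uc szp.
case: (eqVneq y (mate (last y (z :: p)))) => [yl|ny]; last first.
  by rewrite -Ec; apply: (unwrap (y :: z :: p) 0); rewrite ?rot0.
rewrite -Ec; apply: (unwrap (rcons (z :: p) y) 1); first by rewrite Ec rot1_cons.
rewrite /= last_rcons; apply/eqP=> zy.
have lz : last z p = z by rewrite [RHS]zy yl mateK.
have p0 : p = [::] by apply: uniq_last_head lz; case/andP: uc.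
by rewrite p0 in szp.
Qed.

Definition arc x y := (x != y) && e x (mate y).

Lemma cycle_distinct (r : rel T) c : uniq c -> 1 < size c -> cycle r c ->
  cycle (fun x y => (x != y) && r x y) c.
Proof.
case: c => [|x [|y c]] // u _; rewrite !(cycleE _ (x :: y :: c)) => /andP[s l].
apply/andP; split; last first.
  move: l => /= ->; rewrite andbT; apply/eqP => lx.
  by have := uniq_last_head u lx.
elim: c x y u s {l} => [|z c IH] x y.
  by rewrite /= inE !andbT => -> ->.
case/andP=> nx u /andP[rxy s]; have /= := IH y z u s => ->.
by rewrite /= rxy !andbT; move: nx; rewrite inE negb_or => /andP[].
Qed.

Lemma spread_sides a as_ : path e (mate a) (spread as_) ->
  all (fun b => (b \in X) == (a \in X)) as_.
Proof.
elim: as_ a => //= b as_ IH a /and3P[ab _ /IH/allP same].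
have ba : (b \in X) = (a \in X) by rewrite (side_edge ab) side_mate negbK.
by rewrite ba eqxx; apply/allP=> d /same; rewrite ba.
Qed.

Lemma spread_path a as_ z : path e (mate a) (rcons (spread as_) z) =
  path (fun x y => e (mate x) y) a (rcons as_ z).
Proof.
by elim: as_ a => //= b as_ IH a; rewrite IH e_mate.
Qed.

Lemma spread_cycle as_ : cycle e (spread as_) = cycle (fun x y => e (mate x) y) as_.
Proof. by case: as_ => //= a as_; rewrite spread_path e_mate. Qed.

Lemma size_spread as_ : size (spread as_) = (size as_).*2.
Proof. by elim: as_ => //= a as_ ->. Qed.

Lemma spread_cat s1 s2 : spread (s1 ++ s2) = spread s1 ++ spread s2.
Proof. by rewrite /spread map_cat flatten_cat. Qed.

Lemma mem_spread s v : (v \in spread s) = (v \in s) || (mate v \in s).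
Proof.
elim: s => //= a s IH; rewrite !inE IH (can2_eq mateK mateK).
by do 4 case: (_ \in _) || case: (_ == _).
Qed.

(** If the listed vertices are in [X], an edge from [mate a] to [b] is an arc from [b] to [a], so
    the order is reversed. Otherwise it is an arc from [mate a] to [mate b], and the order is
    kept. *)
Lemma M_cycle_arcs c : M_cycle e M c -> 6 <= size c ->
  exists d, [/\ perm_eq d [seq x <- c | x \in X], 2 < size d & cycle arc d].
Proof.
move=> Mc szc; have [as_ [pe u cy]] := M_cycle_spread Mc.
have sza : 2 < size as_.
  by move: szc; rewrite -(perm_size pe) size_spread -[6]/(3.*2) leq_double.
have side : all (fun b => b \in X) as_ \/ all (fun b => b \notin X) as_.
  case: as_ cy {pe u sza} => [|a as_]; first by left.
  rewrite /= rcons_path => /and3P[_ /spread_sides /allP same _].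
  by case: (boolP (a \in X)) same => aX same; [left|right]; rewrite /= ?aX /=;
    apply/allP=> b /same; rewrite ?(negbTE aX) => /eqP ->.
have perm_side d : perm_eq d [seq x <- spread as_ | x \in X] ->
    perm_eq d [seq x <- c | x \in X].
  move=> pd; apply: perm_trans pd _; exact: perm_filter.
rewrite spread_cycle in cy.
case: side => side.
  have E : [seq x <- spread as_ | x \in X] = as_.
    by elim: (as_) side => //= a s IH /andP[aX /IH E];
      rewrite /spread /= side_mate aX /= -/(spread s) E.
  have ua : uniq as_ by rewrite -E filter_uniq.
  exists (rev as_); split; rewrite ?size_rev //.
    by apply: perm_side; rewrite E perm_rev.
  apply: cycle_distinct; rewrite ?rev_uniq ?size_rev //; first exact: ltnW.
  rewrite rev_cycle; move: cy; apply: sub_cycle => x y /=.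
  by rewrite e_sym.
have E : [seq x <- spread as_ | x \in X] = map mate as_.
  by elim: (as_) side => //= a s IH /andP[aX /IH E];
    rewrite /spread /= side_mate aX (negbTE aX) -/(spread s) E.
have ua : uniq (map mate as_) by rewrite -E filter_uniq.
exists (map mate as_); split; rewrite ?size_map //.
  by apply: perm_side; rewrite E.
apply: cycle_distinct; rewrite ?size_map //; first exact: ltnW.
rewrite cycle_map; move: cy; apply: sub_cycle => x y /=.
by rewrite mateK.
Qed.

Lemma spread_uniq s : uniq s -> all (fun x => x \in X) s -> uniq (spread s).
Proof.
elim: s => //= a s IH /andP[na us] /andP[aX sX]; rewrite !inE !mem_spread mateK negb_or.
have nma : mate a \notin s by apply/negP=> /(allP sX); rewrite side_mate aX.
by rewrite eq_sym mate_neq (negbTE na) (negbTE nma) IH.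
Qed.

Lemma inner_spread s : size s <= inner_matching_edges (spread s).
Proof.
elim: s => //= a s; case: s => [|b s] /=; first by rewrite eqxx.
by move=> IH; rewrite eqxx add1n ltnS; apply: leq_trans IH _; exact: leq_addl.
Qed.

(** An arc from [x] to [y] joins [x] to the mate of [y], so a cycle that leaves each vertex through
    its matching edge visits [d] backwards. *)
Lemma spread_M_cycle d : uniq d -> all (fun x => x \in X) d -> 2 < size d ->
  cycle arc d -> M_cycle e M (spread (rev d)).
Proof.
move=> ud dX szd cd.
have us : uniq (spread (rev d)) by rewrite spread_uniq ?rev_uniq ?all_rev.
have cs : cycle e (spread (rev d)).
  rewrite spread_cycle rev_cycle; move: cd; apply: sub_cycle => x y /=.
  by case/andP=> _; rewrite e_sym.
have szr : size (rev d) = size d by rewrite size_rev.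
have {}ud : uniq (rev d) by rewrite rev_uniq.
split; first by rewrite /is_cycle us cs size_spread szr; move: szd; clear; lia.
have := inner_spread (rev d).
have [+ _] := inner_matching_edges_max us (size_spread _).
rewrite size_spread; case: (rev d) szr us ud => [|a s] szr us ur le ge.
  by rewrite -szr in szd.
have na : a != mate (last a (mate a :: spread s)).
  case/lastP: s szr ur {us le ge} => [|s z] szr ur; first by rewrite -szr in szd.
  rewrite -cats1 spread_cat /= last_cat /= mateK.
  by move: ur; rewrite /= mem_rcons inE negb_or => /andP[/andP[]].
by rewrite [spread _]/= (cycle_M_edgesE us) inner_rcons (negbTE na) addn0; congr (_.*2); apply/eqP;
  rewrite eqn_leq le ge.
Qed.

Local Notation V := {x : T | x \in X}.

Lemma count_side (P : pred T) : count (fun x : V => P (val x)) (enum {: V}) = #|[set x in X | P x]|.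
Proof.
rewrite -[LHS](count_map val P) -size_filter.
have u : uniq [seq x <- map val (enum {: V}) | P x].
  by rewrite filter_uniq // map_inj_uniq ?enum_uniq //; exact: val_inj.
rewrite -(card_uniqP u); apply: eq_card => x; rewrite !inE mem_filter andbC; congr (_ && _).
apply/mapP/idP => [[y _ ->]|xX]; first exact: valP.
by exists (exist _ x xX); rewrite ?mem_enum.
Qed.

(** [mate] maps the neighbours of [x] into [X]; the one beyond the arcs is the mate of [x]
    itself. *)
Lemma deg_outd x : x \in X -> deg e x = #|[set y in X | arc x y]|.+1.
Proof.
move=> xX; have -> : deg e x = #|[set y in X | e x (mate y)]|.
  rewrite /deg -[RHS](card_imset _ (can_inj mateK)); apply: eq_card => w.
  rewrite !inE; apply/idP/imsetP => [xw|[y + ->]]; last by rewrite inE => /andP[].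
  by exists (mate w); rewrite ?inE mateK // xw side_mate (side_edge xw) xX.
rewrite (cardsD1 x) !inE xX e_mate add1n; congr _.+1; apply: eq_card => y.
by rewrite !inE /arc eq_sym andbCA.
Qed.

Lemma deg_ind y : y \in X -> deg e (mate y) = #|[set x in X | arc x y]|.+1.
Proof.
move=> yX; have -> : deg e (mate y) = #|[set x in X | e x (mate y)]|.
  rewrite /deg; apply: eq_card => w; rewrite !inE e_sym; case: (boolP (e w (mate y))) => ew.
    by rewrite -[w \in X]negbK -(side_edge ew) side_mate yX.
  by rewrite andbF.
rewrite (cardsD1 y) !inE yX e_mate add1n; congr _.+1; apply: eq_card => x.
by rewrite !inE /arc andbCA.
Qed.

Lemma M_2factor_of_packing k n : 0 < k -> #|X| = n -> 6 * (k + 1) < 2 * n ->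
  sigma11_ge e X (n + 2) ->
  (exists cs : seq (seq T), [/\ size cs = k.+1, vertex_disjoint cs &
     forall c, c \in cs -> M_cycle e M c /\ 6 <= size c]) ->
  exists cs : seq (seq T),
    [/\ M_2factor e M cs, size cs = k & forall c, c \in cs -> 6 <= size c].
Proof.
move=> k0 Xn big sigma [cs [szcs ucs Mcs]].
pose r : rel V := relpre val arc.
have r_irr : irreflexive r by move=> x; rewrite /r /= /arc eqxx.
have szU : size (enum {: V}) = n.
  by rewrite -cardE card_sig -Xn; apply: eq_card => x; rewrite !inE.
(* Each of the two degrees in [G] also counts a matching edge, which turns [n + 2] into [n]. *)
have woodall (x y : V) : x != y -> ~~ r x y ->
    size (enum {: V}) <= outd r (enum {: V}) x + ind r (enum {: V}) y.
  rewrite /r /= {1}/arc -val_eqE => -> /= ne.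
  have myX : mate (val y) \in ~: X by rewrite inE side_mate negbK; exact: valP.
  have := sigma _ _ (valP x) myX ne.
  rewrite (deg_outd (valP x)) (deg_ind (valP y)) /outd /ind /r /=.
  rewrite (count_side (arc (val x))) (count_side (arc^~ (val y))) szU /=.
  by clear; lia.
have [ds [szds lds pds]] : exists ds : seq (seq V), [/\ size ds = size cs, all (long_cycle r) ds &
    perm_eq (map val (flatten ds)) [seq x <- flatten cs | x \in X]].
  elim: (cs) Mcs => [|c cs' IH] M'; first by exists [::].
  have [|ds [szds lds pds]] := IH; first by move=> c' c'cs; apply: M'; rewrite inE c'cs orbT.
  have [Mc szc] := M' c (mem_head _ _).
  have [d [pd szd cd]] := M_cycle_arcs Mc szc.
  have vd : map val (pmap insub d : seq V) = d.
    rewrite (pmap_filter (insubK _)); apply/all_filterP/allP => x.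
    by rewrite (perm_mem pd) mem_filter => /andP[xX _]; rewrite insubT.
  exists ((pmap insub d : seq V) :: ds); split; rewrite /= ?szds //.
    by rewrite lds andbT /long_cycle -(size_map val) vd szd -cycle_map vd.
  by rewrite map_cat vd filter_cat perm_cat.
have [fs [szfs lfs pfs]] : cycle_factor (enum {: V}) r k.
  apply: (cycle_factor_of_packing (enum_uniq _) r_irr woodall k0 _ lds).
  - by rewrite szds.
  - by rewrite -(map_inj_uniq val_inj) (perm_uniq pds) filter_uniq.
  - by move=> x _; rewrite mem_enum.
  by rewrite szU; move: big; clear; lia.
exists [seq spread (rev (map val d)) | d <- fs].
have ufs : uniq (flatten fs) by rewrite (perm_uniq pfs) enum_uniq.
have pf : perm_eq (flatten [seq spread (rev (map val d)) | d <- fs]) (spread (map val (flatten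
    fs))).
  elim: (fs) => //= d fs' IH; rewrite map_cat spread_cat perm_cat //.
  by apply: perm_flatten; apply: perm_map; rewrite perm_rev.
have sideX (d : seq V) : all (fun x => x \in X) (map val d).
  by apply/allP=> x /mapP[y _ ->]; exact: valP.
split; [split; last split | by rewrite size_map |].
- by rewrite /vertex_disjoint (perm_uniq pf) spread_uniq // map_inj_uniq //; exact: val_inj.
- have memX v : v \in X -> v \in map val (flatten fs).
    move=> vX; apply/mapP; exists (exist _ v vX) => //.
    by rewrite (perm_mem pfs) mem_enum.
  move=> v; rewrite (perm_mem pf) mem_spread.
  case: (boolP (v \in X)) => [/memX -> //|vX].
  by rewrite (memX (mate v)) ?orbT // side_mate.
- move=> c /mapP[d dfs ->]; have /andP[szd cd] := allP lfs d dfs.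
  apply: spread_M_cycle; rewrite ?size_map ?cycle_map //.
  rewrite map_inj_uniq; last exact: val_inj.
  move: ufs; rewrite (perm_uniq (perm_flatten (perm_to_rem dfs))) /= cat_uniq.
  by case/andP.
move=> c /mapP[d dfs ->]; have /andP[szd _] := allP lfs d dfs.
by rewrite size_spread size_rev size_map -[6]/(3.*2) leq_double.
Qed.
End Matching.

(** The only member of [M] through [v] has a second end, and finite choice turns these ends into a
    function. *)
Lemma perfect_matching_mate (T : finType) (e : rel T) (M : {set {set T}}) :
  symmetric e -> irreflexive e -> perfect_matching e M ->
  exists mate : T -> T, (forall v, e v (mate v)) /\
    forall v w, ([set v; w] \in M) = (w == mate v).
Proof.
move=> e_sym e_irr [edges cover].
have uniq_edge v m m' : m \in M -> m' \in M -> v \in m -> v \in m' -> m = m'.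
  move=> mM m'M vm vm'; have /eqP/cards1P[m0 E] := cover v.
  have : m \in [set m in M | v \in m] by rewrite inE mM.
  have : m' \in [set m in M | v \in m] by rewrite inE m'M.
  by rewrite E !inE => /eqP-> /eqP->.
have : forall v, exists w, e v w /\ [set v; w] \in M.
  move=> v; have /eqP/cards1P[m E] := cover v.
  have : m \in [set m in M | v \in m] by rewrite E inE.
  rewrite inE => /andP[mM vm]; have [x [y [exy Em]]] := edges m mM.
  move: vm mM; rewrite Em !inE => /orP[] /eqP-> mM; first by exists y.
  by exists x; rewrite e_sym setUC.
case/fin_all_exists=> mate mateM; exists mate; split=> [v|v w]; first by have [] := mateM v.
have [ev vM] := mateM v; apply/idP/eqP => [wM|->//].
have E := uniq_edge v _ _ wM vM; rewrite !inE eqxx in E.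
have := set22 v (mate v); rewrite -(E isT isT) !inE => /orP[] /eqP // mv.
by rewrite mv e_irr in ev.
Qed.

Theorem theorem4 (T : finType) (e : rel T) (X : {set T}) (M : {set {set T}})
    (k n : nat) :
  0 < k ->
  simple_graph e ->
  bipartition e X ->
  #|X| = n -> #|~: X| = n ->
  6 * (k + 1) < 2 * n ->
  perfect_matching e M ->
  (exists cs : seq (seq T),
      [/\ size cs = k.+1, vertex_disjoint cs &
          forall c, c \in cs -> M_cycle e M c /\ 6 <= size c]) ->
  sigma11_ge e X (n + 2) ->
  exists cs : seq (seq T),
    [/\ M_2factor e M cs, size cs = k &
        forall c, c \in cs -> 6 <= size c].
Proof.
move=> k0 [e_sym e_irr] bip Xn _ big pm packing sigma.
have [mate [e_mate mateP]] := perfect_matching_mate e_sym e_irr pm.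
exact: (M_2factor_of_packing e_sym e_irr bip e_mate mateP k0 Xn big sigma packing).
Qed.
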